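(* Let $\pi=\exp(-U)\,\mathrm{d}x$ be a probability measure on $\mathbb{R}^d=\mathbb{R}^{d_1}\times\cdots\times\mathbb{R}^{d_M}$ satisfying the block-wise convexity/smoothness assumption (given in the context) with constants $L_1,\dots,L_M>0$, $\lambda^*>0$, and let $\kappa^*=1/\lambda^*$. Then for any probability measure $\mu$ on $\mathbb{R}^d$, $$\frac{1}{M}\sum_{m=1}^M \mathrm{KL}(\mu_{-m}\,|\,\pi_{-m})\le\left(1-\frac{1}{\kappa^* M}\right)\mathrm{KL}(\mu\,|\,\pi).$$
   Context: Setting: $d=d_1+\dots+d_M$, $\mathcal{X}_m=\mathbb{R}^{d_m}$, $\mathbb{R}^d=\mathcal{X}_1\times\dots\times\mathcal{X}_M$. For $x=(x_1,\dots,x_M)$, $x_{-m}=(x_1,\dots,x_{m-1},x_{m+1},\dots,x_M)\in\mathcal{X}_{-m}=\prod_{i\ne m}\mathcal{X}_i$. For a probability measure $\mu$ on $\mathbb{R}^d$, $\mu_{-m}$ is the marginal law of $X_{-m}$ when $X\sim\mu$. $\mathrm{KL}(\mu|\nu)=\int\log(\mathrm{d}\mu/\mathrm{d}\nu)\,\mathrm{d}\mu$ if $\mu\ll\nu$ and $+\infty$ otherwise. Block-wise convexity/smoothness assumption: $\pi$ has Lebesgue density $\exp(-U)$, with $U:\mathbb{R}^d\to\mathbb{R}$ of the form $U(x)=U_0(x)+\sum_{m=1}^M U_m(x_m)$, where each $U_m:\mathcal{X}_m\to\mathbb{R}$ is convex, $U_0$ is of class $C^1$, and (i) for every $m$ and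 every $\bar x_{-m}\in\mathcal{X}_{-m}$, the map $x_m\mapsto\nabla_m U_0(x_m,\bar x_{-m})$ is $L_m$-Lipschitz ($\nabla_m$ is the gradient in the block $x_m$); (ii) $x\mapsto U_0(x)-\frac{\lambda^*}{2}\|x\|_L^2$ is convex, where $\|x\|_L^2=\sum_{m=1}^M L_m\|x_m\|^2$ and $\lambda^*>0$. One sets $\kappa^*=1/\lambda^*$. *)

(* Defs.v *)
From HB Require Import structures.
From mathcomp Require Import all_boot all_order all_algebra.
From mathcomp Require Import all_classical all_reals all_analysis.
From mathcomp Require Import measurable_realfun.

Set Implicit Arguments.
Unset Strict Implicit.
Unset Printing Implicit Defensive.
Import Order.TTheory GRing.Theory Num.Theory.
Import numFieldNormedType.Exports.
Local Open Scope classical_set_scope.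
Local Open Scope ring_scope.

(* Row vectors carry the sigma-algebra generated by the coordinates, as
   [n.-tuple T] does in the library; [measurable_rVE] shows that it is the
   Borel sigma-algebra. *)
Definition measure_rV_display : measure_display.
Proof. exact: default_measure_display. Qed.

Section measurable_rV.
Context {R : realType} (n : nat).

Definition rV_coord (i : 'I_n) (x : 'rV[R]_n) : R := x 0 i.

Let rV_set0 : g_sigma_preimage rV_coord set0.
Proof. exact: sigma_algebra0. Qed.

Let rV_setC A : g_sigma_preimage rV_coord A -> g_sigma_preimage rV_coord (~` A).
Proof. exact: sigma_algebraC. Qed.

Let rV_bigcup (F : _^nat) : (forall i, g_sigma_preimage rV_coord (F i)) ->
  g_sigma_preimage rV_coord (\bigcup_i (F i)).
Proof. exact: sigma_algebra_bigcup. Qed.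

HB.instance Definition _ := @isMeasurable.Build measure_rV_display
  'rV[R]_n (g_sigma_preimage rV_coord) rV_set0 rV_setC rV_bigcup.

Lemma measurable_rV_coord (i : 'I_n) : measurable_fun setT (rV_coord i).
Proof.
move=> _ Y mY; rewrite setTI; apply: sub_sigma_algebra => /=.
rewrite -bigcup_seq/=; exists i => /=; first by rewrite mem_index_enum.
by exists Y => //; rewrite setTI.
Qed.

Lemma measurable_fun_rVP d (T : measurableType d) (f : T -> 'rV[R]_n) :
  (forall i, measurable_fun setT (fun t => f t 0 i)) -> measurable_fun setT f.
Proof.
move=> mf _ A mA; rewrite setTI.
suff : g_sigma_preimage (fun i => rV_coord i \o f) `<=` measurable.
  apply; rewrite g_sigma_preimage_comp; exists A => //; exact: setTI.
apply: smallest_sub; first exact: sigma_algebra_measurable.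
rewrite -bigcup_seq/=; apply: bigcup_sub => i _.
by move=> B [C mC <-]; exact: mf.
Qed.

Lemma measurable_rV_box (A : 'I_n -> set R) : (forall i, measurable (A i)) ->
  measurable [set x : 'rV[R]_n | forall i, A i (x 0 i)].
Proof.
move=> mA.
rewrite (_ : mkset _ = \bigcap_(i in setT) (rV_coord i @^-1` A i)); last first.
  by apply/seteqP; split => [x h i _|x h i]; exact: h.
apply: fin_bigcap_measurable; first exact: finite_finset.
by move=> i _; rewrite -[X in measurable X]setTI; exact: measurable_rV_coord.
Qed.

End measurable_rV.

Section measurable_rVE.
Context {R : realType} (n : nat).

Lemma open_measurable_rV (O : set 'rV[R]_n) : open O -> measurable O.
Proof.
move=> oO.
pose B (p : 'rV[rat]_n * nat) : set 'rV[R]_n :=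
  [set x | forall i, ball (ratr (p.1 0 i) : R) p.2.+1%:R^-1 (x 0 i)].
have mB p : measurable (B p).
  pose C i := ball (ratr (p.1 0 i) : R) p.2.+1%:R^-1.
  by apply: (measurable_rV_box (A := C)) => i; exact: measurable_ball.
rewrite (_ : O = \bigcup_(k : nat)
    if unpickle k is Some p
    then if `[< B p `<=` O >] then B p else set0 else set0).
  apply: bigcupT_measurable => k.
  by case: unpickle => [p|]; [case: ifPn => _; [exact: mB|]|];
    exact: measurable0.
apply/seteqP; split=> [x Ox|x [k _]]; last first.
  by case: unpickle => // p; case: asboolP => // + Bx; exact.
have /nbhs_ballP[e e0 eO] : nbhs x O by exact: open_nbhs_nbhs.
have [k ke] : exists k, (k.+1%:R^-1 : R) < e / 2.
  have [k _ /(_ k (leqnn k)) /= ke] :=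
    near_infty_natSinv_lt (PosNum (divr_gt0 e0 (ltr0n R 2))).
  by exists k.
have k0 : (0 : R) < k.+1%:R^-1 by rewrite invr_gt0 ltr0n.
have q i : {q : rat | ball (ratr q : R) k.+1%:R^-1 (x 0 i)}.
  apply/cid.
  have /rat_in_itvoo[q] : x 0 i - k.+1%:R^-1 < x 0 i + k.+1%:R^-1.
    by rewrite ltrBlDr -addrA ltrDl addr_gt0.
  rewrite in_itv/= => /andP[q1 q2]; exists q.
  by rewrite /ball/= ltr_norml ltrBrDl q1 ltrBlDl q2.
pose p : 'rV[rat]_n * nat := (\row_i sval (q i), k).
have Bx : B p x by move=> i /=; rewrite mxE; exact: (svalP (q i)).
exists (pickle p) => //; rewrite pickleK asboolT// => y By.
apply: eO; split => // i j; rewrite ord1.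
rewrite (splitr e); apply: (@ball_triangle _ _ (ratr (p.1 0 j) : R)).
  by apply/ball_sym/(le_ball (ltW ke)); exact: Bx.
exact/(le_ball (ltW ke))/By.
Qed.

Lemma measurable_rVE :
  (measurable : set (set 'rV[R]_n)) = <<s (@open 'rV[R]_n) >>.
Proof.
apply/seteqP; split; last first.
  apply: smallest_sub; first exact: sigma_algebra_measurable.
  exact: open_measurable_rV.
apply: smallest_sub; first exact: smallest_sigma_algebra.
rewrite -bigcup_seq/=; apply: bigcup_sub => i _ _ [A mA <-].
have {}mA : (@RGenOpens.G R).-sigma.-measurable A.
  by rewrite -RGenOpens.measurableE.
have : preimage_set_system setT (@rV_coord R n i)
    ((@RGenOpens.G R).-sigma.-measurable) (setT `&` rV_coord i @^-1` A).
  by exists A.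
rewrite -g_sigma_preimageE; apply: sub_smallest2r.
  exact: smallest_sigma_algebra.
move=> _ [_ [a [b ->]] <-].
have /continuousP oi : continuous (@rV_coord R n i).
  by move=> x; exact: coord_continuous.
by rewrite setTI; apply: oi; exact: interval_open.
Qed.

End measurable_rVE.

Section lebesgue_rV.
Context {R : realType}.

Section step.
Variables (n : nat) (m : {sigma_finite_measure set 'rV[R]_n -> \bar R}).

Definition rV_cons (p : measurableTypeR R * 'rV[R]_n) : 'rV[R]_n.+1 :=
  row_mx (p.1 : R)%:M p.2.

Lemma rV_cons0 p : rV_cons p 0 ord0 = p.1.
Proof.
have -> : ord0 = lshift n (0 : 'I_1) :> 'I_(1 + n) by exact/val_inj.
by rewrite /rV_cons (@row_mxEl R 1 1 n) mxE.
Qed.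

Lemma rV_consS p j : rV_cons p 0 (lift ord0 j) = p.2 0 j.
Proof.
have -> : lift ord0 j = rshift 1 j :> 'I_(1 + n) by exact/val_inj.
by rewrite /rV_cons (@row_mxEr R 1 1 n).
Qed.

Lemma measurable_rV_cons : measurable_fun setT rV_cons.
Proof.
apply: measurable_fun_rVP => i; case: (unliftP ord0 i) => [j|] ->.
  rewrite (_ : (fun _ => _) = rV_coord j \o snd).
    exact: (measurableT_comp (measurable_rV_coord j) measurable_snd).
  by apply/funext => p; rewrite rV_consS.
by rewrite (_ : (fun _ => _) = fst) //; apply/funext => p; rewrite rV_cons0.
Qed.

HB.instance Definition _ :=
  isMeasurableFun.Build _ _ _ _ rV_cons measurable_rV_cons.

Definition lebesgue_rVS : set 'rV[R]_n.+1 -> \bar R :=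
  pushforward (lebesgue_measure \x m)%E rV_cons.

Let mpre (A : set 'rV[R]_n.+1) : measurable A -> measurable (rV_cons @^-1` A).
Proof.
by move=> mA; rewrite -[X in measurable X]setTI; exact: measurable_rV_cons.
Qed.

Let lebesgue_rVS0 : lebesgue_rVS set0 = 0%E.
Proof. by rewrite /lebesgue_rVS /pushforward preimage_set0 measure0. Qed.

Let lebesgue_rVS_ge0 A : (0 <= lebesgue_rVS A)%E.
Proof. by rewrite /lebesgue_rVS /pushforward measure_ge0. Qed.

Let lebesgue_rVS_semi_sigma_additive : semi_sigma_additive lebesgue_rVS.
Proof.
move=> F mF tF mUF; rewrite /lebesgue_rVS /pushforward preimage_bigcup.
apply: measure_semi_sigma_additive.
- by move=> k; apply: mpre; exact: mF.
- apply/trivIsetP => /= i j _ _ ij; rewrite -preimage_setI.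
  by move/trivIsetP : tF => /(_ _ _ _ _ ij) ->//; rewrite preimage_set0.
- by rewrite -preimage_bigcup; apply: mpre.
Qed.

HB.instance Definition _ := isMeasure.Build _ _ _ lebesgue_rVS
  lebesgue_rVS0 lebesgue_rVS_ge0 lebesgue_rVS_semi_sigma_additive.

Let lebesgue_rVS_sigma_finite : sigma_finite setT lebesgue_rVS.
Proof.
have /sigma_finiteP[F [TF ndF Foo]] := sigma_finiteT (@lebesgue_measure R).
have /sigma_finiteP[G [TG ndG Goo]] := sigma_finiteT m.
pose H k := F k `*` G k.
have HT : setT = \bigcup_k H k.
  rewrite -setXTT TF TG predeqE => -[x y]; split.
    move=> [/= [k _ Fkx] [l _ Gly]]; exists (maxn k l) => //; split.
    - by move: x Fkx; exact/subsetPset/ndF/leq_maxl.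
    - by move: y Gly; exact/subsetPset/ndG/leq_maxr.
  by move=> [k _ []/= ? ?]; split; exists k.
have mH k : measurable (H k) /\ ((lebesgue_measure \x m) (H k) < +oo)%E.
  have [? ?] := Foo k; have [? ?] := Goo k; split; first exact: measurableX.
  by rewrite product_measure1E// lte_mul_pinfty// ge0_fin_numE.
pose g (x : 'rV[R]_n.+1) : measurableTypeR R * 'rV[R]_n :=
  (x 0 ord0, \row_j x 0 (lift ord0 j)).
have mg : measurable_fun setT g.
  apply/measurable_fun_pairP; split; first exact: (measurable_rV_coord ord0).
  apply: measurable_fun_rVP => j.
  rewrite (_ : (fun _ => _) = rV_coord (lift ord0 j)).
    exact: measurable_rV_coord.
  by apply/funext => x; rewrite /= mxE.
have gK p : g (rV_cons p) = p.
  rewrite /g rV_cons0; case: p => t v; congr pair.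
  by apply/rowP => j; rewrite mxE rV_consS.
exists (fun k => g @^-1` H k); first by rewrite -preimage_bigcup -HT.
move=> k; split; first by rewrite -[X in measurable X]setTI;
  apply: mg => //; exact: (mH k).1.
rewrite /lebesgue_rVS /pushforward -comp_preimage (_ : g \o rV_cons = id).
  exact: (mH k).2.
by apply/funext => p /=; rewrite gK.
Qed.

HB.instance Definition _ := Measure_isSigmaFinite.Build _ _ _
  lebesgue_rVS lebesgue_rVS_sigma_finite.

End step.

Fixpoint lebesgue_rV (n : nat) :
    {sigma_finite_measure set 'rV[R]_n -> \bar R} :=
  match n with
  | 0 => dirac (0 : 'rV[R]_0)
  | n'.+1 => lebesgue_rVS (lebesgue_rV n')
  end.

Lemma lebesgue_rV_box n (A : 'I_n -> set R) : (forall i, measurable (A i)) ->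
  lebesgue_rV n [set x | forall i, A i (x 0 i)] =
  (\prod_(i < n) lebesgue_measure (A i))%E.
Proof.
elim: n A => [A _|n IH A mA].
  by rewrite big_ord0 /= diracE mem_set// => -[].
rewrite big_ord_recl -IH//= /lebesgue_rVS /pushforward -product_measure1E//.
- congr product_measure1; apply/seteqP; split=> [[t v] /= h|[t v] /= [h1 h2] i].
    by split=> [|j]; [have := h ord0; rewrite rV_cons0|
                      have := h (lift ord0 j); rewrite rV_consS].
  by case: (unliftP ord0 i) => [j|] ->;
    rewrite ?rV_cons0 ?rV_consS//; exact: h2.
- exact: mA.
- apply: (measurable_rV_box (A := fun i => A (lift ord0 i))) => i; exact: mA.
Qed.

End lebesgue_rV.

Definition has_lebesgue_density {R : realType} n
    (P : probability 'rV[R]_n R) (f : 'rV[R]_n -> R) : Prop :=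
  forall A, measurable A -> P A = (\int[lebesgue_rV n]_(x in A) (f x)%:E)%E.

(* The Radon-Nikodym derivative is only determined nu-almost everywhere and
   vanishes only on a mu-null set, where the value of lne is irrelevant. *)
Definition KL {R : realType} d (T : measurableType d)
    (mu nu : probability T R) : \bar R :=
  if pselect (mu `<< nu) is left _
  then (\int[mu]_x lne (Radon_Nikodym (charge_of_finite_measure mu) nu x))%E
  else +oo%E.

Section blocks.
Context {R : realType} {M : nat} (d : 'I_M -> nat).

Local Notation X := 'rV[R]_(\sum_m d m).

Definition drop_block (m : 'I_M) (x : X) :
    'rV[R]_(\sum_(j < M.-1) d (lift m j)) :=
  \mxrow_j submxrow x (lift m j).

Lemma measurable_drop_block m : measurable_fun setT (drop_block m).
Proof.
apply: measurable_fun_rVP => i.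
rewrite (_ : (fun _ => _) =
  rV_coord (tagnat.Rank (lift m (tagnat.sig1 i)) (tagnat.sig2 i))).
  exact: measurable_rV_coord.
by apply/funext => x; rewrite !mxE.
Qed.

HB.instance Definition _ m :=
  isMeasurableFun.Build _ _ _ _ (drop_block m) (@measurable_drop_block m).

Definition marginal_drop (m : 'I_M) (mu : probability X R) :
    probability 'rV[R]_(\sum_(j < M.-1) d (lift m j)) R :=
  distribution mu (drop_block m).

(* The point (y, x_{-m}): [x] with its [m]-th block replaced by [y]. *)
Definition set_block (m : 'I_M) (x : X) (y : 'rV[R]_(d m)) : X :=
  \mxrow_i dfwith (fun j => submxrow x j) m y i.

(* The library norm on row vectors is the sup norm. *)
Definition norm2 n (x : 'rV[R]_n) : R := Num.sqrt (\sum_i x 0 i ^+ 2).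

Definition norm2L (L : 'I_M -> R) (x : X) : R :=
  Num.sqrt (\sum_m L m * norm2 (submxrow x m) ^+ 2).

Definition gradient n (f : 'rV[R]_n -> R) (x : 'rV[R]_n) : 'rV[R]_n :=
  \row_i 'D_(delta_mx 0 i) (f : _ -> R^o) x.

Definition class_C1 n (f : 'rV[R]_n -> R) : Prop :=
  (forall x, differentiable (f : _ -> R^o) x) /\ continuous (gradient f).

Definition block_gradient (m : 'I_M) (f : X -> R) (x : X) : 'rV[R]_(d m) :=
  submxrow (gradient f x) m.

Definition potential (U0 : X -> R) (Um : forall m, 'rV[R]_(d m) -> R)
    (x : X) : R :=
  U0 x + \sum_m Um m (submxrow x m).

Record blockwise_convex_smooth (U0 : X -> R) (Um : forall m, 'rV[R]_(d m) -> R)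
    (L : 'I_M -> R) (lambda : R) : Prop := BlockwiseConvexSmooth {
  bcs_convex : forall m, convex_function setT (Um m) ;
  bcs_C1 : class_C1 U0 ;
  bcs_lipschitz : forall m (x : X) (y z : 'rV[R]_(d m)),
    norm2 (block_gradient m U0 (set_block x y) -
           block_gradient m U0 (set_block x z)) <= L m * norm2 (y - z) ;
  bcs_strongly_convex :
    convex_function setT (fun x => U0 x - lambda / 2 * norm2L L x ^+ 2) }.

End blocks.

(* Main.v *)
(* For 0 < t < min(1, lambda) let S_m(x, y) be the point x whose m-th block is moved
   to (1 - t) x_m + t y_m.  The descent lemma in each block and the first-order
   strong convexity inequality for U0 give
     sum_m U(S_m(x, y)) <= (M - t) U(x) + t U(y).
   If prod_m H_m(S_m(x, y)) >= F(x)^(M - t) G(y)^t for all x, y, then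
   prod_m \int H_m >= (\int F)^(M - t) (\int G)^t: by Fubini one treats one
   coordinate at a time, where this is the one-dimensional Prekopa-Leindler
   inequality combined with Hoelder's.  Applied to H_m = exp(g_m - U),
   F = exp(sum_m g_m / (M - t) - U), G = exp(-U), with g_m depending on x_{-m}
   only, it yields a Brascamp-Lieb inequality for pi, whose dual through the
   Donsker-Varadhan formula is
     sum_m KL(mu_{-m} | pi_{-m}) <= (M - t) KL(mu | pi);
   finally t tends to lambda. *)
From HB Require Import structures.
Require Import Defs.
From mathcomp Require Import all_boot all_order all_algebra.
From mathcomp Require Import all_classical all_reals all_analysis.
From mathcomp Require Import measurable_realfun ring lra.

Set Implicit Arguments.
Unset Strict Implicit.
Unset Printing Implicit Defensive.
Import Order.TTheory GRing.Theory Num.Theory.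
Import numFieldNormedType.Exports.
Local Open Scope classical_set_scope.
Local Open Scope ring_scope.

(** The exponent M - t is forced by counting in one coordinate: in M - 1 of the factors H_m it stays
    at x, and in the factor of its own block the point x keeps the share 1 - t. This is the
    homogeneity at which Hoelder on the unmoved factors and Prekopa-Leindler on the moved one fit
    together, and it survives slicing because the remaining coordinates are mixed by the same rule.
    The strict bound t < 1 is essential: the Prekopa-Leindler step takes a root of order 1 - t.
    Since lambda = 1 can occur, t = lambda is reached only as a limit. Integrability is the obstacle
    throughout. The integral inequalities are proved for bounded functions supported in a cube,
    where all integrals are finite reals; cubes are stable under coordinatewise mixing, so the
    pointwise hypothesis survives the restriction. On the entropy side the natural test functions
    are log-densities of the marginals; being unbounded, they are clamped to [-N, N], which costs at
    most e^-N for each block. *)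

Section amgm.
Context {R : realType}.

(** Average ln u <= u - 1 at u = a i / A, where A is the weighted mean. A vanishing a i makes the
    left side 0 and is split off because its logarithm is meaningless. *)
Lemma weighted_amgm (I : finType) (p a : I -> R) :
  (forall i, 0 < p i) -> \sum_i p i = 1 -> (forall i, 0 <= a i) ->
  \prod_i a i `^ p i <= \sum_i p i * a i.
Proof.
move=> p0 p1 a0; set A := \sum_i _.
have pa0 i : 0 <= p i * a i by rewrite mulr_ge0 ?(ltW (p0 i)).
have A0 : 0 <= A by apply: sumr_ge0 => i _.
have [/existsP[i /eqP ai0]|/existsPn aN0] := boolP [exists i, a i == 0].
  by rewrite (bigD1 i)//= ai0 powR0 ?mul0r ?gt_eqF.
have agt0 i : 0 < a i by rewrite lt_neqAle a0 eq_sym aN0.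
have [i _] : exists i : I, true.
  have [i|I0] := pickP (fun _ : I => true); first by exists i.
  by move: p1; rewrite big_pred0// => /eqP; rewrite eq_sym oner_eq0.
have Agt0 : 0 < A.
  rewrite /A (bigD1 i)//= ltr_pwDl ?mulr_gt0// sumr_ge0//.
have -> : \prod_i a i `^ p i = expR (\sum_i p i * ln (a i)).
  rewrite expR_sum; apply: eq_bigr => j _.
  by rewrite /powR gt_eqF.
rewrite -[leRHS]lnK// ler_expR.
rewrite -[leRHS]mul1r -p1 mulr_suml -subr_ge0 -sumrB.
apply: (@le_trans _ _ (\sum_i (p i - p i * a i / A))).
  by rewrite sumrB -mulr_suml -/A divff ?gt_eqF// p1 subrr.
apply: ler_sum => j _.
rewrite -mulrA -[X in X - _]mulr1 -!mulrBr ler_wpM2l ?(ltW (p0 j))//.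
rewrite -lerN2 !opprB -ln_div ?posrE//.
rewrite -[a j / A](subrK 1) addrK [X in ln X]addrC.
by apply: le_ln1Dx; rewrite ltrBrDl subrr divr_gt0.
Qed.

End amgm.

Section hoelder.
Context d (T : measurableType d) (R : realType) (mu : {measure set T -> \bar
  R}).

(** Divide each h i by its integral, apply the weighted mean inequality pointwise and integrate. If
    some integral is 0, then h i, and with it f, vanishes almost everywhere. *)
Lemma hoelder_prod (I : finType) (p : I -> R) (f : T -> R) (h : I -> T -> R) :
  (forall i, 0 < p i) -> \sum_i p i = 1 ->
  mu.-integrable setT (EFin \o f) -> (forall x, 0 <= f x) ->
  (forall i, mu.-integrable setT (EFin \o h i)) -> (forall i x, 0 <= h i x) ->
  (forall x, f x <= \prod_i h i x `^ p i) ->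
  \int[mu]_x f x <= \prod_i (\int[mu]_x h i x) `^ p i.
Proof.
move=> p0 p1 fi f0 hi h0 fh.
have I0 i : 0 <= \int[mu]_x h i x by apply: Rintegral_ge0.
have [/existsP[i /eqP hi0]|/existsPn hN0] := boolP [exists i, \int[mu]_x h i x
  == 0].
  rewrite [leLHS](_ : _ = 0); first by apply: prodr_ge0 => j _; exact: powR_ge0.
  rewrite /Rintegral (_ : (\int[mu]_x (f x)%:E = 0)%E)//.
  have : (\int[mu]_x `|(h i x)%:E| = 0)%E.
    under eq_integral do rewrite gee0_abs ?lee_fin//.
    have := integrable_fin_num measurableT (hi i) => /fineK <-.
    by move: hi0; rewrite /Rintegral => ->.
  move/(ae_eq_integral_abs mu measurableT (measurable_int mu (hi i))) => h0ae.
  have := measurable_int mu fi => mf.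
  rewrite -[RHS](@integral0 _ _ _ mu setT).
  apply: ae_eq_integral => //.
  move: h0ae; apply: filterS => x /= hx _; have [hx0] := hx Logic.I; congr EFin.
  apply/eqP; rewrite eq_le f0 andbT (le_trans (fh x))//.
  by rewrite (bigD1 i)//= hx0 powR0 ?mul0r// gt_eqF.
have Igt0 i : 0 < \int[mu]_x h i x by rewrite lt_neqAle I0 eq_sym hN0.
pose J i := \int[mu]_x h i x.
pose P := \prod_i J i `^ p i.
have P0 : 0 < P by apply: prodr_gt0 => i _; exact/powR_gt0/Igt0.
have step x : f x <= P * \sum_i p i * (h i x / J i).
  apply: (le_trans (fh x)).
  rewrite -ler_pdivrMl// (le_trans _ (weighted_amgm p0 p1 _))//; last first.
    by move=> i; apply: divr_ge0; [exact: h0|exact: I0].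
  rewrite /P -prodfV -big_split/= ler_prod// => i _.
  rewrite mulr_ge0 ?invr_ge0 ?powR_ge0//=.
  by rewrite powRM ?invr_ge0 ?(I0 i)// mulrC -[(J i)^-1]powR_inv1 ?(I0 i)//
    -powRrM mulN1r powRN.
have hji i : mu.-integrable setT (EFin \o (fun x => p i * (h i x / J i))).
  rewrite (_ : EFin \o _ = fun x => (p i / J i)%:E * (EFin \o h i) x)%E.
    exact: integrableZl.
  by apply/funext => x /=; rewrite -EFinM; congr EFin; ring.
have si : mu.-integrable setT (EFin \o (fun x => \sum_i p i * (h i x / J i))).
  rewrite (_ : EFin \o _ =
      fun x => (\sum_i (EFin \o (fun x => (p i * (h i x / J i))%R) : T -> \bar
        R) x)%E).
    exact: integrable_sum.
  by apply/funext => x /=; rewrite sumEFin.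
have psi : mu.-integrable setT (EFin \o (fun x => P * \sum_i p i * (h i x / J
  i))).
  rewrite (_ : EFin \o _ = fun x =>
      P%:E * (EFin \o (fun x => (\sum_i p i * (h i x / J i))%R)) x)%E//.
  exact: integrableZl.
apply: (le_trans (le_Rintegral measurableT fi psi _)) => //.
rewrite RintegralZl// -[leRHS]mulr1 ler_wpM2l ?(ltW P0)//.
rewrite /Rintegral.
under eq_integral do rewrite -sumEFin.
rewrite integral_sum//=.
rewrite (eq_bigr (fun i => (p i)%:E)).
  by rewrite sumEFin p1.
move=> i _.
transitivity (\int[mu]_x ((p i / J i)%:E * (EFin \o h i) x))%E.
  by apply: eq_integral => x _ /=; rewrite -EFinM; congr EFin; ring.
rewrite integralZl//=.
have -> : (\int[mu]_x (h i x)%:E = (J i)%:E)%E.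
  by rewrite /J /Rintegral fineK//; apply: (integrable_fin_num measurableT (hi
    i)).
by rewrite -EFinM -mulrA mulVf ?mulr1// gt_eqF// Igt0.
Qed.

End hoelder.

(** * Brunn-Minkowski and Prekopa-Leindler inequalities on the real line *)

Section lebesgue_affine.
Context {R : realType}.
Local Notation leb := (@lebesgue_measure R).

Definition affine (s c : R) (x : measurableTypeR R) : measurableTypeR R :=
  s * x + c.

Lemma measurable_affine s c : measurable_fun setT (affine s c).
Proof.
by apply: measurable_funD => //; exact: measurable_funM.
Qed.

HB.instance Definition _ s c := isMeasurableFun.Build _ _ _ _ (affine s c)
  (measurable_affine s c).

(** The right side is a measure in A that agrees with Lebesgue measure on half-open intervals, so
    uniqueness applies. *)
Lemma lebesgue_measure_affine (s c : R) (A : set R) : 0 < s -> measurable A ->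
  leb A = (s%:E * leb (affine s c @^-1` A))%E.
Proof.
move=> s0 mA.
pose sn := NngNum (ltW s0).
rewrite (lebesgue_measure_unique (mu := mscale sn (pushforward leb (affine s
  c))))//.
move=> _ [[a b]] _ <-.
transitivity (s%:E * leb (affine s c @^-1` `]a, b]))%E; last by [].
rewrite (_ : affine s c @^-1` _ = `](a - c) / s, (b - c) / s]%classic).
  rewrite !lebesgue_measure_itv/= !lte_fin ltr_pM2r ?invr_gt0// ltrBlDr subrK.
  case: ifPn => _; last by rewrite mule0.
  by rewrite -!EFinD -EFinM; congr EFin; field; rewrite gt_eqF.
apply/seteqP; split => x /=; rewrite !in_itv/= /affine.
  by rewrite ltr_pdivrMr// ler_pdivlMr// ltrBlDr lerBrDr mulrC.
by rewrite ltr_pdivrMr// ler_pdivlMr// ltrBlDr lerBrDr mulrC.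
Qed.

Lemma affine_subset_le (s c : R) (A D : set R) : 0 < s -> measurable A ->
  measurable D -> (forall a, A a -> D (s * a + c)) -> (s%:E * leb A <= leb D)%E.
Proof.
move=> s0 mA mD AD; rewrite (lebesgue_measure_affine c s0 mD).
apply: lee_wpmul2l; first by rewrite lee_fin ltW.
apply: le_measure; rewrite ?inE//.
by apply: measurable_funPTI.
Qed.

(* Translates of A and B by nearly extremal points of each other are almost
   disjoint, so no compactness is needed. *)
Lemma brunn_minkowski1 (t N : R) (A B C : set R) : 0 < t -> t < 1 ->
  measurable A -> measurable B -> measurable C -> A !=set0 -> B !=set0 ->
  (forall a, A a -> a <= N) -> (forall b, B b -> - N <= b) ->
  (forall a b, A a -> B b -> C ((1 - t) * a + t * b)) ->
  ((1 - t)%:E * leb A + t%:E * leb B <= leb C)%E.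
Proof.
move=> t0 t1 mA mB mC A0 B0 AN BN ABC.
have t1' : 0 < 1 - t by rewrite subr_gt0.
apply/lee_addgt0Pr => e e0.
have supA : has_sup A by split => //; exists N => a /AN.
have infB : has_inf B by split => //; exists (- N) => a /BN.
have [a Aa sa] : exists2 a, A a & sup A - e < a.
  by have [a Aa sa] := sup_adherent e0 supA; exists a.
have [b Bb ib] : exists2 b, B b & b < inf B + e.
  by have [b Bb ib] := inf_adherent e0 infB; exists b.
pose c1 := (1 - t) * sup A + t * b.
pose c2 := (1 - t) * a + t * inf B.
have H1 : ((1 - t)%:E * leb A <= leb (C `&` `]-oo, c1]))%E.
  apply: (affine_subset_le (c := t * b)) => //; first exact: measurableI.
  move=> x Ax; split; first exact: ABC.
  rewrite /= in_itv/= lerD2r ler_pM2l//; apply: sup_upper_bound => //.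
have H2 : (t%:E * leb B <= leb (C `&` `[c2, +oo[))%E.
  apply: (affine_subset_le (c := (1 - t) * a)) => //; first exact: measurableI.
  move=> x Bx; split; first by rewrite addrC; exact: ABC.
  rewrite /= in_itv/= andbT /c2 addrC lerD2r ler_pM2l//; by apply: ge_inf =>
    //; case: infB.
have H3 : (leb (C `&` `[c2, +oo[) <= leb (C `&` `]c1, +oo[) + e%:E)%E.
  apply: (@le_trans _ _ (leb ((C `&` `]c1, +oo[) `|` `[c2, c1]))).
    apply: le_measure; rewrite ?inE; [exact: measurableI|
      by apply: measurableU => //; exact: measurableI|].
    move=> x [Cx] /=; rewrite !in_itv/= !andbT => c2x.
    by case: (ltP c1 x) => xc; [left; split => //=; rewrite in_itv/= xc|right;
      rewrite c2x].
  apply: (le_trans (measureU2 _ _ _)) => //; first exact: measurableI.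
  apply: leeD => //.
  rewrite [leLHS](lebesgue_measure_itv `[c2, c1])/=; case: ifPn => _; last
    first.
    by rewrite lee_fin ltW.
  rewrite -EFinD lee_fin /c1 /c2.
  rewrite (_ : _ - _ = (1 - t) * (sup A - a) + t * (b - inf B)); last by ring.
  have -> : e = (1 - t) * e + t * e by ring.
  by apply: lerD; rewrite ler_pM2l//; lra.
have -> : leb C = (leb (C `&` `]-oo, c1]) + leb (C `&` `]c1, +oo[))%E.
  rewrite -measureU//; [|exact: measurableI|exact: measurableI|].
    rewrite -setIUr -(_ : setT = `]-oo, c1] `|` `]c1, +oo[) ?setIT//.
    apply/seteqP; split => // x _ /=; rewrite !in_itv/= andbT.
    by case: (leP x c1) => ?; [left|right].
  apply/seteqP; split => // x [[_ /=]] + [_] /=; rewrite !in_itv/= andbT.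
  by rewrite leNgt => /negP.
rewrite -addeA; apply: leeD => //; exact: (le_trans H2).
Qed.

End lebesgue_affine.

Section layer_cake.
Context d (T : measurableType d) (R : realType).
Variable mu : {sigma_finite_measure set T -> \bar R}.
Local Notation leb := (@lebesgue_measure R).
Variables (f : T -> R) (mf : measurable_fun setT f) (f0 : forall x, 0 <= f x).

Let E : set (T * measurableTypeR R) := [set p | 0 <= p.2 < f p.1].

Let mE : measurable E.
Proof.
pose u (p : T * measurableTypeR R) := (0 <= p.2).
pose v (p : T * measurableTypeR R) := (p.2 < f p.1).
rewrite (_ : E = u @^-1` [set true] `&` v @^-1` [set true]); last first.
  by apply/seteqP; split => p /= => [/andP|[? ?]] //; apply/andP; split.
apply: measurableI.
- have : measurable_fun setT u by exact: measurable_fun_ler.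
  by move=> /(_ measurableT [set true]); rewrite setTI; exact.
- have : measurable_fun setT v.
    by apply: measurable_fun_ltr => //; exact: measurableT_comp.
  by move=> /(_ measurableT [set true]); rewrite setTI; exact.
Qed.

Let layerE s : [set x | 0 <= s < f x] = ysection E s.
Proof. by apply/seteqP; split=> x; rewrite ysectionP. Qed.

Lemma measurable_layer :
  measurable_fun setT
    (fun s : measurableTypeR R => mu [set x | 0 <= (s : R) < f x]).
Proof.
rewrite (_ : (fun _ => _) = mu \o ysection E).
  exact: measurable_fun_ysection.
by apply/funext => s /=; rewrite layerE.
Qed.

(** Tonelli for the indicator of the region under the graph. The condition 0 <= s empties the layers
    at negative levels, so that s can range over the whole line. *)
Lemma layer_cake :
  (\int[mu]_x (f x)%:E = \int[leb]_s mu [set x | (0 <= s < f x)%R])%E.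
Proof.
transitivity (\int[mu]_x \int[leb]_s (\1_E (x, s))%:E)%E.
  apply: eq_integral => x _.
  transitivity (\int[leb]_s (\1_`[0%R, f x[ s)%:E)%E.
    rewrite integral_indic// setIT [RHS](lebesgue_measure_itv `[0, f x[)/=
      lte_fin.
    by case: ltgtP (f0 x) => // [_|<-]; rewrite ?oppr0 ?adde0.
  by apply: eq_integral => s _; rewrite !indicE.
rewrite (fubini_tonelli (fun p : T * measurableTypeR R => (\1_E p)%:E))//; last
  first.
  by apply/measurable_EFinP; exact: measurable_indic.
apply: eq_integral => s _.
rewrite layerE -[X in mu X]setIT -integral_indic//; last exact:
  measurable_ysection.
apply: eq_integral => x _; rewrite !indicE; congr ((nat_of_bool _)%:R%:E).
by apply/idP/idP => /set_mem xsE; apply/mem_set; move: xsE; rewrite ysectionP.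
Qed.

End layer_cake.

Section prekopa_leindler.
Context {R : realType}.
Local Notation leb := (@lebesgue_measure R).

Lemma layer_measurable (f : R -> R) s : measurable_fun setT f ->
  measurable [set x | 0 <= s < f x].
Proof.
move=> mf; have [s0|s0] := boolP (0 <= s); last first.
  by rewrite (_ : mkset _ = set0)//; apply/seteqP; split.
rewrite (_ : mkset _ = [set x | s < f x])//.
have := measurable_fun_ltr (measurable_cst s) mf.
by move=> /(_ measurableT [set true]); rewrite setTI; exact.
Qed.

(** Brunn-Minkowski level by level, then the layer-cake formula. It fails for empty sets, hence the
    normalization of both suprema to 1: f and g have nonempty layers at exactly the same levels,
    those in [0, 1). In return the conclusion has an arithmetic mean on the left. *)
Lemma prekopa_leindler_sup1 (t N : R) (f g h : R -> R) : 0 < t -> t < 1 ->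
  measurable_fun setT f -> measurable_fun setT g -> measurable_fun setT h ->
  (forall x, 0 <= f x <= 1) -> (forall x, 0 <= g x <= 1) ->
  (forall x, 0 <= h x) ->
  (forall s, s < 1 -> exists x, s < f x) ->
  (forall s, s < 1 -> exists x, s < g x) ->
  (forall x, f x != 0 -> x <= N) -> (forall x, g x != 0 -> - N <= x) ->
  (forall s x y, 0 <= s -> s < f x -> s < g y -> s < h ((1 - t) * x + t * y)) ->
  ((1 - t)%:E * \int[leb]_x (f x)%:E + t%:E * \int[leb]_x (g x)%:E
    <= \int[leb]_x (h x)%:E)%E.
Proof.
move=> t0 t1 mf mg mh f01 g01 h0 f1 g1 fN gN fgh.
have f0 x : 0 <= f x by case/andP: (f01 x).
have g0 x : 0 <= g x by case/andP: (g01 x).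
have t1' : 0 <= 1 - t by lra.
rewrite !(layer_cake leb)//.
rewrite -!ge0_integralZl ?lee_fin ?(ltW t0)//; try exact: measurable_layer.
rewrite -ge0_integralD//; last 4 first.
- by move=> s _; rewrite mule_ge0 ?lee_fin.
- by apply: measurable_funeM; exact: measurable_layer.
- by move=> s _; rewrite mule_ge0 ?lee_fin// ltW.
- by apply: measurable_funeM; exact: measurable_layer.
apply: ge0_le_integral => //.
- by move=> s _; rewrite adde_ge0// mule_ge0 ?lee_fin// ltW.
- by apply: emeasurable_funD; apply: measurable_funeM; exact: measurable_layer.
- exact: measurable_layer.
move=> s _; have [s0|s0] := boolP (0 <= s); last first.
  have e0 (u : R -> R) : [set x | false && (s < u x)] = set0.
    by apply/seteqP; split.
  by rewrite !e0 measure0 !mule0 adde0.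
have [s1|s1] := ltP s 1; last first.
  have e0 (u : R -> R) : (forall x, 0 <= u x <= 1) ->
      [set x | true && (s < u x)] = set0.
    move=> u01; apply/seteqP; split => //= x /=.
    by rewrite ltNge (le_trans _ s1)//; case/andP: (u01 x).
  by rewrite (e0 f)// (e0 g)// measure0 !mule0 adde0.
have ne (u : R) : s < u -> u != 0 by move=> su; rewrite gt_eqF// (le_lt_trans
  s0).
apply: (@brunn_minkowski1 _ t N) => //=.
- by have := layer_measurable s mf; rewrite s0.
- by have := layer_measurable s mg; rewrite s0.
- by have := layer_measurable s mh; rewrite s0.
- by have [x sx] := f1 _ s1; exists x.
- by have [x sx] := g1 _ s1; exists x.
- by move=> x /ne /fN.
- by move=> x /ne /gN.
- by move=> x y; exact: fgh.
Qed.

End prekopa_leindler.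

Section bounded_in.
Context d (T : measurableType d) (R : realType).
Implicit Types (D : set T) (K : R) (f : T -> R).

(** With D of finite measure, this makes f integrable and is inherited by slices and by slice
    integrals, so the induction on dimension needs no separate integrability argument. *)
Definition bounded_in D K f := [/\ measurable_fun setT f,
  forall x, 0 <= f x <= K & forall x, f x != 0 -> D x].

Lemma bounded_in_ge0 D K f x : bounded_in D K f -> 0 <= f x.
Proof. by case=> _ /(_ x) /andP[]. Qed.

Lemma bounded_in_le D K f x : bounded_in D K f -> f x <= K.
Proof. by case=> _ /(_ x) /andP[]. Qed.

Lemma bounded_in_le_indic D K f x : bounded_in D K f -> f x <= K * \1_D x.
Proof.
move=> [_ /(_ x)/andP[f0 fK] /(_ x) fD]; rewrite indicE.
have [fx0|/fD Dx] := eqVneq (f x) 0; last by rewrite mem_set// mulr1.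
by rewrite fx0 mulr_ge0// (le_trans f0).
Qed.

Variable mu : {measure set T -> \bar R}.

Let integrable_indic_lty D : measurable D -> (mu D < +oo)%E ->
  mu.-integrable setT (EFin \o (\1_D : T -> R)).
Proof.
move=> mD Doo; apply/integrableP; split.
  by apply/measurable_EFinP; exact: measurable_indic.
under eq_integral do rewrite gee0_abs ?lee_fin//.
by rewrite integral_indic// setIT.
Qed.

Lemma bounded_in_integrable D K f : measurable D -> (mu D < +oo)%E ->
  bounded_in D K f -> mu.-integrable setT (EFin \o f).
Proof.
move=> mD Doo fb; have [mf _ _] := fb.
apply: (@le_integrable _ _ _ mu _ _ _ (EFin \o (fun x => K * \1_D x))) => //.
- exact/measurable_EFinP.
- move=> x _ /=; rewrite lee_fin ger0_norm ?(bounded_in_ge0 _ fb)//.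
  by rewrite (le_trans (bounded_in_le_indic x fb))// ler_norm.
- rewrite (_ : EFin \o _ = fun x => K%:E * (EFin \o \1_D) x)%E//.
  apply: integrableZl => //; exact: integrable_indic_lty.
Qed.

Lemma bounded_in_Rintegral D K f : measurable D -> (mu D < +oo)%E ->
  bounded_in D K f -> 0 <= \int[mu]_x f x <= K * fine (mu D).
Proof.
move=> mD Doo fb; have fi := bounded_in_integrable mD Doo fb.
rewrite Rintegral_ge0/=; last by move=> x _; exact: bounded_in_ge0 fb.
have Di : mu.-integrable setT (EFin \o (\1_D : T -> R)).
  exact: integrable_indic_lty.
apply: (@le_trans _ _ (\int[mu]_x (K * \1_D x))).
  apply: le_Rintegral => //; last by move=> x _; exact: bounded_in_le_indic.
  rewrite (_ : EFin \o _ = fun x => K%:E * (EFin \o \1_D) x)%E//.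
  exact: integrableZl.
by rewrite RintegralZl// /Rintegral integral_indic// setIT.
Qed.

End bounded_in.

Section prekopa_leindler.
Context {R : realType}.
Local Notation leb := (@lebesgue_measure R).
Local Notation I N := (`[- N, N]%classic : set R).

Lemma leb_segment_lty (N : R) : (leb (I N) < +oo)%E.
Proof.
by rewrite lebesgue_measure_itv/=; case: ifP => // _; rewrite -EFinD ltry.
Qed.

Lemma bounded_in_leb_integrable N K (f : R -> R) : bounded_in (I N) K f ->
  leb.-integrable setT (EFin \o f).
Proof.
move=> fb.
exact: (@bounded_in_integrable _ (measurableTypeR R) _ leb (I N) K f
  (measurable_itv _) (leb_segment_lty N) fb).
Qed.

Lemma amgm2 (t a b : R) : 0 < t -> t < 1 -> 0 <= a -> 0 <= b ->
  a `^ (1 - t) * b `^ t <= (1 - t) * a + t * b.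
Proof.
move=> t0 t1 a0 b0.
have := @weighted_amgm _ bool (fun c => if c then t else 1 - t)
  (fun c => if c then b else a).
rewrite !big_bool/= mulrC [leRHS]addrC; apply.
- by case; rewrite ?subr_gt0.
- by rewrite addrC subrK.
- by case.
Qed.

(** Rescale f and g by their suprema a and b, and h by c = a^(1 - t) b^t: levels match because s c =
    (s a)^(1 - t) (s b)^t. The mean inequality then turns the arithmetic mean of the normalized
    integrals into the product, and the scalings cancel. *)
Lemma prekopa_leindler (t N K : R) (f g h : R -> R) : 0 < t -> t < 1 ->
  bounded_in (I N) K f -> bounded_in (I N) K g ->
  measurable_fun setT h -> (forall x, 0 <= h x) ->
  leb.-integrable setT (EFin \o h) ->
  (forall x y, f x `^ (1 - t) * g y `^ t <= h ((1 - t) * x + t * y)) ->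
  (\int[leb]_x f x) `^ (1 - t) * (\int[leb]_x g x) `^ t <= \int[leb]_x h x.
Proof.
move=> t0 t1 fb gb mh h0 hi fgh.
have t1' : 0 < 1 - t by rewrite subr_gt0.
have hI0 : 0 <= \int[leb]_x h x by apply: Rintegral_ge0.
have supP (u : R -> R) : bounded_in (I N) K u ->
    \int[leb]_x u x = 0 \/ [/\ 0 < sup (range u), forall x, u x <= sup (range u)
      & forall s, s < sup (range u) -> exists x, s < u x].
  move=> ub; have [[x ux0]|u0] := pselect (exists x, u x != 0); last first.
    left; rewrite /Rintegral (_ : (\int[leb]_x (u x)%:E = 0)%E)//.
    apply: integral0_eq => x _; congr EFin; apply/eqP.
    by apply: contrapT => /negP ux; apply: u0; exists x.
  have sU : has_sup (range u).
    by split; [exists (u x), x|exists K => _ [y _ <-]; exact: bounded_in_le ub].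
  have uS y : u y <= sup (range u) by apply: sup_upper_bound => //; exists y.
  right; split => // [|s su].
    by rewrite (lt_le_trans _ (uS x))// lt_neqAle eq_sym ux0 (bounded_in_ge0 _
      ub).
  have [_ [y _ <-]] := sup_gt sU.1 su; by exists y.
have [->|[a0 fa asup]] := supP _ fb; first by rewrite powR0 ?mul0r// gt_eqF.
have [->|[b0 gb' bsup]] := supP _ gb; first by rewrite mulrC powR0 ?mul0r//
  gt_eqF.
set a := sup _ in a0 fa asup; set b := sup _ in b0 gb' bsup.
pose c := a `^ (1 - t) * b `^ t.
have c0 : 0 < c by rewrite mulr_gt0 ?powR_gt0.
have fi := bounded_in_leb_integrable fb.
have gi := bounded_in_leb_integrable gb.
have [mf f0 fN] := fb; have [mg g0 gN] := gb.
have Zi (u : R -> R) (r : R) : leb.-integrable setT (EFin \o u) ->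
    (\int[leb]_x (u x / r)%:E = (r^-1 * \int[leb]_x u x)%:E)%E.
  move=> ui; rewrite /Rintegral EFinM fineK ?integrable_fin_num//.
  rewrite -integralZl//; apply: eq_integral => x _.
  by rewrite mulrC EFinM.
have key : (1 - t) * (a^-1 * \int[leb]_x f x) + t * (b^-1 * \int[leb]_x g x) <=
    c^-1 * \int[leb]_x h x.
  rewrite -lee_fin EFinD !(EFinM _ (_ * _)) -!Zi//.
  apply: (@prekopa_leindler_sup1 _ t N (fun x => f x / a) (fun x => g x / b)
    (fun x => h x / c)) => //.
  - exact: measurable_funM.
  - exact: measurable_funM.
  - exact: measurable_funM.
  - move=> x; rewrite ler_pdivrMr// mul1r fa divr_ge0//; last exact: ltW.
    by have /andP[] := f0 x.
  - move=> x; rewrite ler_pdivrMr// mul1r gb' divr_ge0//; last exact: ltW.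
    by have /andP[] := g0 x.
  - by move=> x; rewrite divr_ge0// ltW.
  - move=> s s1; have [|x] := asup (s * a); first by rewrite gtr_pMl.
    by exists x; rewrite ltr_pdivlMr.
  - move=> s s1; have [|x] := bsup (s * b); first by rewrite gtr_pMl.
    by exists x; rewrite ltr_pdivlMr.
  - move=> x fx; have : f x != 0 by apply: contraNneq fx => ->; rewrite mul0r.
    by move=> /fN; rewrite /= in_itv/= => /andP[].
  - move=> x gx; have : g x != 0 by apply: contraNneq gx => ->; rewrite mul0r.
    by move=> /gN; rewrite /= in_itv/= => /andP[].
  - move=> s x y s0 sf sg; rewrite ltr_pdivlMr// (lt_le_trans _ (fgh x y))//.
    have sf' : s * a < f x by rewrite -ltr_pdivlMr.
    have sg' : s * b < g y by rewrite -ltr_pdivlMr.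
    have -> : s * c = (s * a) `^ (1 - t) * (s * b) `^ t.
      rewrite !powRM ?(ltW a0) ?(ltW b0)// mulrACA -powRD ?subrK ?powRr1//.
      by rewrite oner_eq0.
    apply: ltr_pM; rewrite ?powR_ge0//; apply: gt0_ltr_powR => //;
      by rewrite nnegrE ?mulr_ge0// ltW// (le_lt_trans _ sf', le_lt_trans _
        sg')// mulr_ge0// ltW.
have If0 : 0 <= \int[leb]_x f x by apply: Rintegral_ge0 => x _; have /andP[] :=
  f0 x.
have Ig0 : 0 <= \int[leb]_x g x by apply: Rintegral_ge0 => x _; have /andP[] :=
  g0 x.
have ai0 : 0 <= a^-1 by rewrite invr_ge0 ltW.
have bi0 : 0 <= b^-1 by rewrite invr_ge0 ltW.
have /le_trans/(_ key) := amgm2 t0 t1 (mulr_ge0 ai0 If0) (mulr_ge0 bi0 Ig0).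
rewrite !powRM// mulrACA -[_^-1]powR_inv1 ?(ltW a0)// -[b^-1]powR_inv1 ?(ltW
  b0)//.
rewrite -!powRrM mulrC !mulN1r !powRN -invfM -/c ler_pdivrMr// mulrAC.
by rewrite mulVf ?mul1r// gt_eqF.
Qed.

End prekopa_leindler.

(** * The inequality with exponents M - t and t: one coordinate, then induction on the dimension *)

Section one_coordinate.
Context {R : realType} (M : nat).
Local Notation leb := (@lebesgue_measure R).
Local Notation I N := (`[- N, N]%classic : set R).

Lemma powR_prod (J : finType) (P : pred J) (u : J -> R) (p : R) :
  (forall j, 0 <= u j) -> (\prod_(j | P j) u j) `^ p = \prod_(j | P j) u j `^ p.
Proof.
move=> u0.
have [_] : 0 <= \prod_(j | P j) u j /\
    (\prod_(j | P j) u j) `^ p = \prod_(j | P j) u j `^ p; last by [].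
elim/big_ind2: _ => [|x1 x2 y1 y2 [x0 <-] [y0 <-]|j _].
- by rewrite powR1.
- by rewrite powRM// mulr_ge0.
- by [].
Qed.

(* Prekopa-Leindler applied to [k] below, which is designed so that
   [k x `^ (1 - t) * g y `^ t <= h b ((1 - t) * x + t * y)], followed by
   Hoelder's inequality for
   [f = k ^ ((1 - t) / (M - t)) * prod_(m != b) h m ^ (1 / (M - t))]. *)
Lemma coordinate_prekopa_leindler (b : 'I_M) (t N K : R) (f g : R -> R)
    (h : 'I_M -> R -> R) : 0 < t -> t < 1 ->
  bounded_in (I N) K f -> bounded_in (I N) K g ->
  (forall m, bounded_in (I N) K (h m)) ->
  (forall x y, f x `^ (M%:R - t) * g y `^ t <=
    \prod_m h m (if m == b then (1 - t) * x + t * y else x)) ->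
  (\int[leb]_x f x) `^ (M%:R - t) * (\int[leb]_x g x) `^ t <=
    \prod_m \int[leb]_x h m x.
Proof.
move=> t0 t1 fb gb hb fgh.
have t1' : 0 < 1 - t by rewrite subr_gt0.
have M1 : (1 : R) <= M%:R by rewrite ler1n (leq_ltn_trans (leq0n b)).
have Mt : 0 < M%:R - t by rewrite subr_gt0 (lt_le_trans t1).
have h0 m x : 0 <= h m x := bounded_in_ge0 x (hb m).
have Ih0 m : 0 <= \int[leb]_x h m x by apply: Rintegral_ge0.
(* The point [y0] serves twice: it gives an upper bound for [k], and it forces f to vanish wherever
   the product [P] does. *)
have [[y0 gy0]|g0] := pselect (exists y, 0 < g y); last first.
  rewrite (_ : \int[leb]_x g x = 0).
    by rewrite mulrC powR0 ?mul0r ?prodr_ge0// gt_eqF.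
  rewrite /Rintegral (_ : (\int[leb]_x (g x)%:E = 0)%E)//.
  apply: integral0_eq => x _; congr EFin; apply/eqP.
  rewrite eq_le (bounded_in_ge0 x gb) andbT leNgt.
  by apply/negP => gx; apply: g0; exists x.
have f0 x : 0 <= f x := bounded_in_ge0 x fb.
have g0 x : 0 <= g x := bounded_in_ge0 x gb.
have [mf _ fN] := fb.
pose P x := \prod_(m | m != b) h m x.
have P0 x : 0 <= P x by apply: prodr_ge0.
have mP : measurable_fun setT P.
  rewrite (_ : P = fun x => \prod_(m <- [seq m <- index_enum 'I_M | m != b]) h
    m x).
    by apply: measurable_prod => m _; case: (hb m).
  by apply/funext => x; rewrite big_filter.
have fP x y : f x `^ (M%:R - t) * g y `^ t <= P x * h b ((1 - t) * x + t * y).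
  rewrite (le_trans (fgh x y))// (bigD1 b)//= eqxx mulrC ler_wpM2r//.
  by rewrite le_eqVlt; apply/orP; left; apply/eqP; apply: eq_bigr => m /negbTE
    ->.
pose k x := (f x `^ (M%:R - t) * P x `^ (-1)) `^ (1 - t)^-1.
have kE x : k x `^ (1 - t) = f x `^ (M%:R - t) / P x.
  by rewrite -powRrM mulVf ?gt_eqF// powRr1 ?mulr_ge0 ?powR_ge0// powR_inv1.
have kg x y : k x `^ (1 - t) * g y `^ t <= h b ((1 - t) * x + t * y).
  rewrite kE; have [->|Px] := eqVneq (P x) 0.
    by rewrite invr0 mulr0 mul0r.
  have Px0 : 0 < P x by rewrite lt_neqAle eq_sym Px P0.
  by rewrite mulrAC ler_pdivrMr// [leRHS]mulrC.
have gt0 : 0 < g y0 `^ t by apply: powR_gt0.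
have K0 : 0 <= K by rewrite (le_trans (f0 0))// (bounded_in_le _ fb).
pose K' := Num.max K ((K / g y0 `^ t) `^ (1 - t)^-1).
have kb : bounded_in (I N) K' k.
  split.
  - apply: (measurableT_comp (measurable_powR _)); apply: measurable_funM.
      exact: (measurableT_comp (measurable_powR _)).
    exact: (measurableT_comp (measurable_powR _)).
  - move=> x; rewrite powR_ge0/= le_max; apply/orP; right.
    rewrite (_ : k x = (k x `^ (1 - t)) `^ (1 - t)^-1); last first.
      by rewrite -powRrM divff ?gt_eqF// powRr1// powR_ge0.
    apply: ge0_ler_powR; rewrite ?nnegrE ?powR_ge0 ?invr_ge0 ?(ltW t1')//.
      by rewrite divr_ge0 ?powR_ge0.
    by rewrite ler_pdivlMr// (le_trans (kg x y0))// (bounded_in_le _ (hb b)).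
  - move=> x kx; apply: fN; apply: contraNneq kx => fx.
    have [n1 n2] : M%:R - t != 0 /\ (1 - t)^-1 != 0.
      by rewrite !gt_eqF ?invr_gt0.
    by rewrite /k fx (powR0 n1) mul0r (powR0 n2).
have gb' : bounded_in (I N) K' g.
  have [mg _ gN] := gb; split=> // x; rewrite g0/= le_max.
  by rewrite (bounded_in_le _ gb).
have hi m := bounded_in_leb_integrable (hb m).
have [mhb _ _] := hb b.
have PL := prekopa_leindler t0 t1 kb gb' mhb (h0 b) (hi b) kg.
pose q m := if m == b then k else h m.
pose p (m : 'I_M) := if m == b then (1 - t) / (M%:R - t) else (M%:R - t)^-1.
have p0 m : 0 < p m by rewrite /p; case: ifP => _; rewrite ?divr_gt0 ?invr_gt0.
have p1 : \sum_m p m = 1.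
  rewrite (bigD1 b)//= /p eqxx.
  rewrite (eq_bigr (fun _ => (M%:R - t)^-1)); last by move=> m /negbTE ->.
  rewrite sumr_const cardC1 card_ord -[_^-1 *+ _]mulr_natl.
  have -> : M.-1%:R = M%:R - 1 :> R.
    by rewrite -[in RHS](@prednK M) ?(leq_ltn_trans (leq0n b))// -natr1 addrK.
  by field; rewrite gt_eqF.
have q0 m x : 0 <= q m x by rewrite /q; case: ifP => _; rewrite ?powR_ge0.
have qi m : leb.-integrable setT (EFin \o q m).
  by rewrite /q; case: ifP => _ //; exact: bounded_in_leb_integrable kb.
have fq x : f x <= \prod_m q m x `^ p m.
  rewrite (_ : \prod_m _ = (k x `^ (1 - t) * P x) `^ (M%:R - t)^-1); last first.
    rewrite (bigD1 b)//= /q /p eqxx powRM ?powR_ge0// -powRrM; congr (_ * _).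
    by rewrite powR_prod//; apply: eq_bigr => m /negbTE ->.
  rewrite -[leLHS](_ : (f x `^ (M%:R - t)) `^ (M%:R - t)^-1 = _); last first.
    by rewrite -powRrM divff ?gt_eqF// powRr1.
  apply: ge0_ler_powR; rewrite ?nnegrE ?mulr_ge0 ?powR_ge0 ?invr_ge0 ?(ltW
    Mt)//.
  rewrite kE; have [Px|Px] := eqVneq (P x) 0; last by rewrite divfK.
  have := fP x y0; rewrite Px mul0r mulr0 pmulr_lle0//.
have If0 : 0 <= \int[leb]_x f x by apply: Rintegral_ge0.
have Ik0 : 0 <= \int[leb]_x k x by apply: Rintegral_ge0 => x _; exact: powR_ge0.
have := hoelder_prod p0 p1 (bounded_in_leb_integrable fb) f0 qi q0 fq.
rewrite (bigD1 b)//= /q /p eqxx => Hf.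
have Y0 : 0 <= \prod_(m | m != b) (\int[leb]_x h m x) `^ (M%:R - t)^-1.
  by apply: prodr_ge0 => m _; exact: powR_ge0.
have {}Hf : (\int[leb]_x f x) `^ (M%:R - t) <=
    (\int[leb]_x k x) `^ (1 - t) * \prod_(m | m != b) \int[leb]_x h m x.
  rewrite (_ : _ * _ = ((\int[leb]_x k x) `^ ((1 - t) / (M%:R - t)) *
      \prod_(m | m != b) (\int[leb]_x h m x) `^ (M%:R - t)^-1) `^ (M%:R - t)).
    apply: ge0_ler_powR.
    - exact: ltW.
    - by rewrite nnegrE.
    - by rewrite nnegrE mulr_ge0 ?powR_ge0.
    - apply: (le_trans Hf); apply: ler_wpM2l; first exact: powR_ge0.
      rewrite le_eqVlt; apply/orP; left; apply/eqP.
      by apply: eq_bigr => m /negbTE ->.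
  rewrite powRM ?powR_ge0// -powRrM divfK ?gt_eqF//; congr (_ * _).
  rewrite powR_prod => [|m]; last exact: powR_ge0.
  apply: eq_bigr => m _; by rewrite -powRrM mulVf ?gt_eqF// powRr1.
rewrite (bigD1 b)//=.
apply: (le_trans (ler_wpM2r (powR_ge0 _ _) Hf)).
by rewrite mulrAC; apply: ler_wpM2r => //; exact: prodr_ge0.
Qed.

End one_coordinate.

Section blockwise.
Context {R : realType} (M : nat).
Local Notation leb := (@lebesgue_measure R).
Local Notation I N := (`[- N, N]%classic : set R).

Definition cube n (N : R) : set 'rV[R]_n := [set x | forall i, I N (x 0 i)].
Arguments cube : clear implicits.

Lemma measurable_cube n N : measurable (cube n N).
Proof. by apply: (measurable_rV_box (A := fun=> I N)). Qed.

Lemma lebesgue_cube_lty n N : (lebesgue_rV n (cube n N) < +oo)%E.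
Proof.
rewrite (lebesgue_rV_box (A := fun=> I N))//.
suff /andP[] : (0 <= \prod_(i < n) leb (I N) < +oo)%E by [].
elim/big_ind: _ => [|x y /andP[x0 xoo] /andP[y0 yoo]|i _].
- by rewrite ltry andbT.
- by rewrite mule_ge0//= lte_mul_pinfty// ge0_fin_numE.
- by rewrite measure_ge0 leb_segment_lty.
Qed.

(** This is the point S_m(x, y). Blocks are given by an arbitrary labelling [b] of the coordinates,
    possibly with empty blocks, so that deleting a coordinate stays within the same setting. *)
Definition mix_block n (b : 'I_n -> 'I_M) (t : R) (m : 'I_M) (x y : 'rV[R]_n) :
    'rV[R]_n :=
  \row_i (if b i == m then (1 - t) * x 0 i + t * y 0 i else x 0 i).

Lemma mix_block_cons n (b : 'I_n.+1 -> 'I_M) t m (x y : R) (v w : 'rV[R]_n) :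
  mix_block b t m (rV_cons (x, v)) (rV_cons (y, w)) =
  rV_cons ((if m == b ord0 then (1 - t) * x + t * y else x),
           mix_block (fun i => b (lift ord0 i)) t m v w).
Proof.
apply/rowP => i; rewrite mxE; case: (unliftP ord0 i) => [j|] ->.
  by rewrite !rV_consS/= mxE.
by rewrite !rV_cons0/= eq_sym.
Qed.

Definition slice_integral n (F : 'rV[R]_n.+1 -> R) (x : R) : R :=
  \int[lebesgue_rV n]_v F (rV_cons (x, v)).

Section slices.
Variables (n : nat) (N K : R) (F : 'rV[R]_n.+1 -> R).
Hypothesis Fb : bounded_in (cube n.+1 N) K F.

Lemma bounded_in_slice x : bounded_in (cube n N) K (fun v => F (rV_cons (x,
  v))).
Proof.
have [mF F0 FN] := Fb; split.
- apply: (measurableT_comp mF) => /=.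
  exact: (measurableT_comp (@measurable_rV_cons R n) (measurable_pair1 x)).
- by move=> v; exact: F0.
- by move=> v /FN cv i; have := cv (lift ord0 i); rewrite rV_consS.
Qed.

Lemma slice_integralE x :
  (slice_integral F x)%:E = (\int[lebesgue_rV n]_v (F (rV_cons (x, v)))%:E)%E.
Proof.
rewrite /slice_integral /Rintegral fineK//.
apply: integrable_fin_num => //.
apply: (bounded_in_integrable (measurable_cube N) (lebesgue_cube_lty n N)).
exact: bounded_in_slice.
Qed.

Let mFc : measurable_fun setT
  (fun p : measurableTypeR R * 'rV[R]_n => (F (rV_cons p))%:E).
Proof.
have [mF _ _] := Fb; apply/measurable_EFinP.
exact: (measurableT_comp mF (@measurable_rV_cons R n)).
Qed.

Lemma bounded_in_slice_integral :
  bounded_in (I N) (K * fine (lebesgue_rV n (cube n N))) (slice_integral F).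
Proof.
have [mF F0 FN] := Fb; split.
- apply/measurable_EFinP.
  rewrite (_ : EFin \o _ = fubini_F (lebesgue_rV n)
     (fun p : measurableTypeR R * 'rV[R]_n => (F (rV_cons p))%:E)).
    apply: measurable_fun_fubini_tonelli_F => // p.
    by rewrite lee_fin (bounded_in_ge0 _ Fb).
  by apply/funext => x /=; rewrite slice_integralE.
- move=> x; apply: bounded_in_Rintegral (bounded_in_slice x).
    exact: measurable_cube.
  exact: lebesgue_cube_lty.
- move=> x; apply: contra_neqP => xN; rewrite /slice_integral /Rintegral.
  rewrite (_ : (\int[_]_v _ = 0)%E)//; apply: integral0_eq => v _.
  congr EFin; apply/eqP; apply: contrapT => /negP/FN /(_ ord0).
  by rewrite rV_cons0.
Qed.

Lemma Rintegral_slice_integral :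
  \int[leb]_x slice_integral F x = \int[lebesgue_rV n.+1]_x F x.
Proof.
have [mF F0 FN] := Fb; rewrite /Rintegral; congr fine.
transitivity (\int[leb]_x \int[lebesgue_rV n]_v (F (rV_cons (x, v)))%:E)%E.
  by apply: eq_integral => x _; rewrite slice_integralE.
rewrite -(fubini_tonelli1 (fun p : measurableTypeR R * 'rV[R]_n =>
  (F (rV_cons p))%:E))//; last by move=> p; rewrite lee_fin (bounded_in_ge0 _
    Fb).
rewrite ge0_integral_pushforward//.
  exact/measurable_EFinP.
by move=> y _; rewrite lee_fin (bounded_in_ge0 _ Fb).
Qed.

End slices.

(** For fixed first coordinates x and y, the slices satisfy the hypothesis in one dimension less;
    the induction hypothesis is then exactly the pointwise assumption of the one-coordinate
    inequality for the slice integrals. In dimension 0 the integrals are values at the single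
    point. *)
Lemma blockwise_prekopa_leindler n (b : 'I_n -> 'I_M) (t N K : R)
    (F G : 'rV[R]_n -> R) (H : 'I_M -> 'rV[R]_n -> R) : 0 < t -> t < 1 ->
  bounded_in (cube n N) K F -> bounded_in (cube n N) K G ->
  (forall m, bounded_in (cube n N) K (H m)) ->
  (forall x y, F x `^ (M%:R - t) * G y `^ t <=
    \prod_m H m (mix_block b t m x y)) ->
  (\int[lebesgue_rV n]_x F x) `^ (M%:R - t) * (\int[lebesgue_rV n]_x G x) `^ t
    <=
    \prod_m \int[lebesgue_rV n]_x H m x.
Proof.
move=> t0 t1; elim: n => [|n IH] in b K F G H *.
  move=> [mF _ _] [mG _ _] Hb FGH.
  have int0 (u : 'rV[R]_0 -> R) : measurable_fun setT u ->
      \int[lebesgue_rV 0]_x u x = u 0.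
    move=> mu; rewrite /Rintegral/= integral_dirac//; last
      exact/measurable_EFinP.
    by rewrite diracT mul1e.
  rewrite !int0//; apply: (le_trans (FGH 0 0)); rewrite le_eqVlt.
  apply/orP; left; apply/eqP; apply: eq_bigr => m _.
  rewrite int0; last by case: (Hb m).
  by congr (H m _); apply/rowP => -[].
move=> Fb Gb Hb FGH.
rewrite -(Rintegral_slice_integral Fb) -(Rintegral_slice_integral Gb).
rewrite (eq_bigr (fun m => \int[leb]_x slice_integral (H m) x)); last first.
  by move=> m _; rewrite (Rintegral_slice_integral (Hb m)).
apply: (@coordinate_prekopa_leindler _ _ (b ord0) t N
  (K * fine (lebesgue_rV n (cube n N)))) => //.
- exact: bounded_in_slice_integral.
- exact: bounded_in_slice_integral.
- by move=> m; exact: bounded_in_slice_integral.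
move=> x y.
apply: (IH (fun i => b (lift ord0 i)) K (fun v => F (rV_cons (x, v)))
  (fun v => G (rV_cons (y, v)))
  (fun m v => H m (rV_cons ((if m == b ord0 then (1 - t) * x + t * y else x),
    v)))).
- exact: bounded_in_slice.
- exact: bounded_in_slice.
- by move=> m; exact: bounded_in_slice.
- move=> v w; apply: (le_trans (FGH _ _)); rewrite le_eqVlt.
  apply/orP; left; apply/eqP; apply: eq_bigr => m _.
  by rewrite mix_block_cons.
Qed.

End blockwise.
Arguments cube {R} n N.

(** * Descent lemma, strong convexity and the potential at mixed points *)

Section line_derivative.
Context {R : realType} (n : nat).
Implicit Types (f : 'rV[R]_n -> R) (x v : 'rV[R]_n).

Lemma derive_gradient f x v : differentiable (f : _ -> R^o) x ->
  'D_v (f : _ -> R^o) x = \sum_i v 0 i * gradient f x 0 i.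
Proof.
move=> df; rewrite deriveE//.
rewrite {1}(row_sum_delta v) linear_sum/=; apply: eq_bigr => i _.
by rewrite linearZ/= mxE deriveE.
Qed.

Lemma is_derive_line f x v (s : R) : differentiable (f : _ -> R^o) (s *: v + x)
  ->
  is_derive s 1 (fun s : R => f (s *: v + x) : R^o) ('D_v (f : _ -> R^o) (s *:
    v + x)).
Proof.
move=> df.
have E : (fun h : R => h^-1 *: ((f (((h *: (1 : R)) + s) *: v + x) : R^o)
    - f (s *: v + x))) =
  (fun h : R => h^-1 *: ((f (h *: v + (s *: v + x)) : R^o) - f (s *: v + x))).
  by apply/funext => h; rewrite addrA -scalerDl [_ *: (1 : R)]mulr1.
have := diff_derivable (v := v) df.
split; first by rewrite /derivable E.
by rewrite /derive E.
Qed.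

End line_derivative.

Section descent.
Context {R : realType} (n M : nat) (b : 'I_n -> 'I_M) (L : 'I_M -> R).
Variables (f : 'rV[R]_n -> R) (lambda : R).
Hypothesis L_gt0 : forall m, 0 < L m.
Hypothesis df : forall x, differentiable (f : _ -> R^o) x.

Let Q (x : 'rV[R]_n) : R := \sum_i L (b i) * x 0 i ^+ 2.

Hypothesis f_lipschitz : forall m (x y : 'rV[R]_n),
  (forall i, b i != m -> x 0 i = y 0 i) ->
  \sum_(i | b i == m) (gradient f x 0 i - gradient f y 0 i) ^+ 2 <=
  L m ^+ 2 * \sum_(i | b i == m) (x 0 i - y 0 i) ^+ 2.

Hypothesis f_convex : forall (x v : 'rV[R]_n) (s : R), 0 <= s <= 1 ->
  f (s *: v + x) - lambda / 2 * Q (s *: v + x) <=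
  (1 - s) * (f x - lambda / 2 * Q x) + s * (f (v + x) - lambda / 2 * Q (v + x)).

Let Q_line x v s : Q (s *: v + x) =
  Q x + 2 * s * (\sum_i L (b i) * (x 0 i * v 0 i)) + s ^+ 2 * Q v.
Proof.
rewrite /Q !mulr_sumr -!big_split/=; apply: eq_bigr => i _.
by rewrite !mxE; ring.
Qed.

(** First-order form of strong convexity: divide the inequality on the segment by its parameter h
    and let h decrease to 0. Since [Q] is quadratic, the remaining correction is linear in h. *)
Lemma tangent_le x v :
  'D_v (f : _ -> R^o) x <= f (v + x) - f x - lambda / 2 * Q v.
Proof.
have key h : 0 < h -> h <= 1 ->
    h^-1 * (f (h *: v + x) - f x) - h * (lambda / 2 * Q v) <=
    f (v + x) - f x - lambda / 2 * Q v.
  move=> h0 h1; have := @f_convex x v h; rewrite (ltW h0) h1 => /(_ isT).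
  have := Q_line x v 1; rewrite scale1r Q_line => -> H.
  rewrite lerBlDr mulrC ler_pdivrMr// -subr_ge0.
  move: H; rewrite -subr_ge0; congr (0 <= _); ring.
have := diff_derivable (v := v) (df x) => dvf.
pose g (h : R) : R := h^-1 * (f (h *: v + x) - f x) - h * (lambda / 2 * Q v).
have cg : g h @[h --> 0^'+] --> ('D_v (f : _ -> R^o) x : R).
  rewrite -[X in _ --> X]subr0; apply: cvgB.
    exact: (cvg_dnbhs_at_right dvf).
  rewrite -[X in _ --> X](mul0r (lambda / 2 * Q v)); apply: cvgM; last exact:
    cvg_cst.
  apply: cvg_at_right_filter; exact: cvg_id.
have cvg_g : cvg (g h @[h --> 0^'+]) by apply/cvg_ex; eexists; exact: cg.
rewrite -(cvg_lim _ cg)//; apply: limr_le => //.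
near=> h; apply: key; near: h; [exact: nbhs_right_gt|].
by apply: nbhs_right_le.
Unshelve. all: by end_near.
Qed.

(** Mean value theorem for f along the line minus its claimed quadratic bound. As v lives in block
    m, the derivative of the difference involves only the block gradient, and the Lipschitz bound
    makes it nonpositive. *)
Lemma descent m (x v : 'rV[R]_n) (t : R) : 0 <= t -> (forall i, b i != m -> v 0
  i = 0) ->
  f (t *: v + x) <= f x + t * 'D_v (f : _ -> R^o) x +
    t ^+ 2 / 2 * (L m * \sum_(i | b i == m) v 0 i ^+ 2).
Proof.
rewrite le_eqVlt => /predU1P[<- _|t0 vm].
  by rewrite scale0r add0r expr0n/= !mul0r !addr0.
set D := 'D_v _ x; set V := \sum_(i | _) _.
pose psi (s : R) : R^o := f (s *: v + x) - (s * D + s ^+ 2 * (L m * V / 2)).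
pose dpsi (s : R) : R := 'D_v (f : _ -> R^o) (s *: v + x) - (D + s * (L m * V)).
have dpsiE (s : R) : is_derive s (1 : R) (psi : R -> R^o) (dpsi s).
  have A := is_derive_line (df (s *: v + x)).
  have := is_deriveB A (is_deriveD (is_deriveZ D (is_derive_id s 1))
    (is_deriveZ (L m * V / 2) (is_deriveX 2 (is_derive_id s 1)))).
  set F1 := (X in is_derive _ _ X _); rewrite (_ : F1 = psi); last first.
    apply/funext => u; rewrite /psi; set C := L m * V / 2.
    transitivity (f (u *: v + x) - (D * u + C * u ^+ 2)); first by [].
    by congr (_ - (_ + _)); rewrite mulrC.
  move=> H; apply: (is_derive_eq H); rewrite /dpsi; set C := L m * V / 2.
  transitivity ('D_v (f : _ -> R^o) (s *: v + x) - (D * 1 + C * ((2 * s) * 1))).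
    by [].
  by rewrite /C !mulr1; congr (_ - (_ + _)); field.
have cpsi : {within `[0, t], continuous psi}.
  by apply: derivable_within_continuous => s _; have [] := dpsiE s.
have [c] := MVT t0 (fun s _ => dpsiE s) cpsi.
rewrite in_itv/= => /andP[c0 ct].
rewrite /psi scale0r add0r mul0r expr0n/= mul0r addr0 !subr0 => E.
suff : dpsi c <= 0.
  move=> dc; have : dpsi c * t <= 0 by rewrite mulr_le0_ge0// ltW.
  by rewrite -E -/D; lra.
rewrite /dpsi /D !derive_gradient//.
rewrite opprD addrA -sumrB subr_le0.
rewrite (bigID (fun i => b i == m))/= [X in _ + X]big1 ?addr0; last first.
  by move=> i bi; rewrite vm// !mul0r subrr.
have Lc : 0 < L m * c by rewrite mulr_gt0.
have := @f_lipschitz m (c *: v + x) x.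
have -> : \sum_(i | b i == m) ((c *: v + x) 0 i - x 0 i) ^+ 2 = c ^+ 2 * V.
  rewrite /V mulr_sumr; apply: eq_bigr => i _; rewrite !mxE; ring.
have cvx i : b i != m -> (c *: v + x) 0 i = x 0 i.
  by move=> /vm vi; rewrite !mxE vi mulr0 add0r.
move=> /(_ cvx) lip.
(* Young's inequality replaces Cauchy-Schwarz. With the weight L m * c both halves are at most (L m
   * c / 2) V, which adds up to the required bound. *)
apply: (@le_trans _ _ (\sum_(i | b i == m)
  ((2 * (L m * c))^-1 * (gradient f (c *: v + x) 0 i - gradient f x 0 i) ^+ 2 +
   (L m * c) / 2 * v 0 i ^+ 2))).
  apply: ler_sum => i _; set u := gradient f x 0 i; set w := gradient _ _ _ _.
  rewrite -subr_ge0 (_ : _ - _ = (2 * (L m * c))^-1 * (w - u - L m * c * v 0 i)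
    ^+ 2).
    by rewrite mulr_ge0 ?sqr_ge0 ?invr_ge0 ?mulr_ge0// ltW.
  by field; rewrite !gt_eqF.
rewrite big_split/= -!mulr_sumr -/V.
have : (2 * (L m * c))^-1 *
     (\sum_(i | b i == m) (gradient f (c *: v + x) 0 i - gradient f x 0 i) ^+ 2)
     <= (2 * (L m * c))^-1 * (L m ^+ 2 * (c ^+ 2 * V)).
  by rewrite ler_wpM2l// invr_ge0 mulr_ge0// ltW.
have -> : (2 * (L m * c))^-1 * (L m ^+ 2 * (c ^+ 2 * V)) = L m * c / 2 * V.
  by field; rewrite !gt_eqF.
lra.
Qed.

(** The block increments add up to y - x, so the first-order terms sum to one directional derivative
    and the second-order terms to (t^2 / 2) Q(y - x). Strong convexity pays for (t lambda / 2) Q(y -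
    x), which suffices because t <= lambda. *)
Lemma sum_mix_block_le (x y : 'rV[R]_n) (t : R) : 0 <= t -> t <= lambda ->
  \sum_m f (mix_block b t m x y) <= (M%:R - t) * f x + t * f y.
Proof.
move=> t0 tl.
pose v m : 'rV[R]_n := \row_i (if b i == m then y 0 i - x 0 i else 0).
have mixE m : mix_block b t m x y = t *: v m + x.
  by apply/rowP => i; rewrite !mxE; case: ifP => _; ring.
pose D := 'D_(y - x) (f : _ -> R^o) x.
have DE : \sum_m 'D_(v m) (f : _ -> R^o) x = D.
  rewrite /D derive_gradient//; under eq_bigr do rewrite derive_gradient//.
  rewrite exchange_big/=; apply: eq_bigr => i _.
  rewrite -mulr_suml; congr (_ * _).
  rewrite (bigD1 (b i))//= !mxE eqxx big1 ?addr0// => m /negbTE bm.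
  by rewrite mxE eq_sym bm.
have QE : \sum_m L m * \sum_(i | b i == m) v m 0 i ^+ 2 = Q (y - x).
  rewrite /Q (partition_big b xpredT)//=; apply: eq_bigr => m _.
  rewrite mulr_sumr; apply: eq_bigr => i /eqP bi.
  by rewrite !mxE bi eqxx.
have H : \sum_m f (mix_block b t m x y) <=
    \sum_m (f x + t * 'D_(v m) (f : _ -> R^o) x +
    t ^+ 2 / 2 * (L m * \sum_(i | b i == m) v m 0 i ^+ 2)).
  apply: ler_sum => m _; rewrite mixE; apply: descent => // i /negbTE bi.
  by rewrite mxE bi.
apply: (le_trans H); rewrite !big_split/= sumr_const card_ord -!mulr_sumr DE QE.
have /(ler_wpM2l t0) := tangent_le x (y - x); rewrite subrK -/D => T.
rewrite -[f x *+ M]mulr_natl.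
have Q0 : 0 <= Q (y - x).
  by apply: sumr_ge0 => i _; rewrite mulr_ge0 ?sqr_ge0// ltW.
have : t * (lambda - t) / 2 * Q (y - x) >= 0.
  by rewrite !mulr_ge0// subr_ge0.
by move: T; set q := Q _; nra.
Qed.

(** A unit step from 0 along one coordinate exceeds the linear approximation by at least lambda L /
    2 and by at most L / 2. *)
Lemma strong_convexity_le1 (i0 : 'I_n) : lambda <= 1.
Proof.
pose v : 'rV[R]_n := delta_mx 0 i0.
have vE i : v 0 i = (i == i0)%:R by rewrite mxE.
have QE : Q v = L (b i0).
  rewrite /Q (bigD1 i0)//= vE eqxx expr1n mulr1 big1 ?addr0// => i /negbTE ii0.
  by rewrite vE ii0 expr0n/= mulr0.
have vb i : b i != b i0 -> v 0 i = 0.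
  by rewrite vE; have [->|//] := eqVneq i i0; rewrite eqxx.
have := descent 0 ler01 vb; have := tangent_le 0 v.
rewrite scale1r QE expr1n mul1r (bigD1 i0)//= vE eqxx expr1n big1 ?addr0; last
  first.
  by move=> i /andP[_ /negbTE ii0]; rewrite vE ii0 expr0n.
rewrite mulr1 mul1r => H1 H2.
have : lambda / 2 * L (b i0) <= 2^-1 * L (b i0) by lra.
by rewrite ler_pM2r//; lra.
Qed.

End descent.

Section block_sums.
Context {R : realType} {M : nat} (d : 'I_M -> nat).
Local Notation n := (\sum_m d m)%N.

Lemma sum_blocks (F : 'I_n -> R) :
  \sum_i F i = \sum_m \sum_(k < d m) F (tagnat.Rank m k).
Proof.
rewrite (sig_big_dep xpredT (fun _ => xpredT)
  (fun m k => F (tagnat.Rank m k)))/=.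
rewrite (reindex (@tagnat.sig M d))/=; last exact: onW_bij tagnat.sig_bij.
by apply: eq_bigr => i _; congr F; rewrite -[LHS]tagnat.sig2K.
Qed.

Lemma sum_block (F : 'I_n -> R) (m : 'I_M) :
  \sum_(i | tagnat.sig1 i == m) F i = \sum_(k < d m) F (tagnat.Rank m k).
Proof.
rewrite big_mkcond sum_blocks (bigD1 m)//= [X in _ + X]big1 ?addr0.
  by apply: eq_bigr => k _; rewrite tagnat.Rank1K eqxx.
move=> j /negbTE jm; apply: big1 => k _.
by rewrite tagnat.Rank1K jm.
Qed.

Lemma norm2_sqr k (x : 'rV[R]_k) : norm2 x ^+ 2 = \sum_i x 0 i ^+ 2.
Proof. by rewrite sqr_sqrtr// sumr_ge0// => i _; exact: sqr_ge0. Qed.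

Lemma norm2_ge0 k (x : 'rV[R]_k) : 0 <= norm2 x.
Proof. exact: sqrtr_ge0. Qed.

Lemma norm2L_sqr (L : 'I_M -> R) (x : 'rV[R]_n) : (forall m, 0 < L m) ->
  norm2L L x ^+ 2 = \sum_i L (tagnat.sig1 i) * x 0 i ^+ 2.
Proof.
move=> L0; rewrite sqr_sqrtr; last first.
  by apply: sumr_ge0 => m _; rewrite mulr_ge0 ?sqr_ge0// ltW.
rewrite sum_blocks; apply: eq_bigr => m _; rewrite norm2_sqr mulr_sumr.
by apply: eq_bigr => k _; rewrite !mxE tagnat.Rank1K.
Qed.

(** Translates the Lipschitz assumption, stated with [set_block], to pairs of points that agree off
    block m. *)
Lemma set_block_submxrow (m : 'I_M) (x y : 'rV[R]_n) :
  (forall i, tagnat.sig1 i != m -> x 0 i = y 0 i) ->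
  set_block y (submxrow x m) = x.
Proof.
move=> xy; apply/mxrowP => j; rewrite mxrowK.
have [->|jm] := eqVneq j m; first by rewrite dfwithin.
rewrite dfwithout 1?eq_sym//; apply/rowP => k; rewrite !mxE xy//.
by rewrite tagnat.Rank1K.
Qed.

End block_sums.

Section assumption.
Context {R : realType} {M : nat} (d : 'I_M -> nat).
Local Notation n := (\sum_m d m)%N.

Lemma convex_functionE (E : lmodType R) (f : E -> R) :
  convex_function setT (f : E -> R^o) -> forall (x y : E) (s : R), 0 <= s <= 1
    ->
  f (s *: x + (1 - s) *: y) <= s * f x + (1 - s) * f y.
Proof.
move=> fc x y s /andP[s0 s1].
by have := fc (Itv01 s0 s1) x y (in_setT _) (in_setT _).
Qed.

Variables (U0 : 'rV[R]_n -> R) (Um : forall m, 'rV[R]_(d m) -> R).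
Variables (L : 'I_M -> R) (lambda : R).
Hypothesis L_gt0 : forall m, 0 < L m.
Hypothesis assumption : blockwise_convex_smooth U0 Um L lambda.
Local Notation b := (@tagnat.sig1 M d).

Let U0_diff x : differentiable (U0 : _ -> R^o) x.
Proof. by case: assumption => _ []. Qed.

Let U0_lipschitz m (x y : 'rV[R]_n) :
  (forall i, b i != m -> x 0 i = y 0 i) ->
  \sum_(i | b i == m) (gradient U0 x 0 i - gradient U0 y 0 i) ^+ 2 <=
  L m ^+ 2 * \sum_(i | b i == m) (x 0 i - y 0 i) ^+ 2.
Proof.
move=> xy; have := bcs_lipschitz assumption y (submxrow x m) (submxrow y m).
rewrite !set_block_submxrow// => lip.
have := ler_pM (norm2_ge0 _) (norm2_ge0 _) lip lip.
rewrite -!expr2 exprMn !norm2_sqr !sum_block.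
have gE k : (block_gradient m U0 x - block_gradient m U0 y) 0 k =
    gradient U0 x 0 (tagnat.Rank m k) - gradient U0 y 0 (tagnat.Rank m k).
  by rewrite !mxE.
have xE k : (submxrow x m - submxrow y m) 0 k =
    x 0 (tagnat.Rank m k) - y 0 (tagnat.Rank m k).
  by rewrite !mxE.
by rewrite (eq_bigr _ (fun k _ => congr1 (fun u => u ^+ 2) (gE k)))
  (eq_bigr _ (fun k _ => congr1 (fun u => u ^+ 2) (xE k))).
Qed.

Let U0_convex (x v : 'rV[R]_n) (s : R) : 0 <= s <= 1 ->
  U0 (s *: v + x) - lambda / 2 * (\sum_i L (b i) * (s *: v + x) 0 i ^+ 2) <=
  (1 - s) * (U0 x - lambda / 2 * (\sum_i L (b i) * x 0 i ^+ 2)) +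
  s * (U0 (v + x) - lambda / 2 * (\sum_i L (b i) * (v + x) 0 i ^+ 2)).
Proof.
move=> s01; have := convex_functionE (bcs_strongly_convex assumption) (v + x) x
  s01.
rewrite (_ : s *: (v + x) + (1 - s) *: x = s *: v + x); last first.
  by rewrite scalerDr -addrA -scalerDl [s + _]addrC subrK scale1r.
by rewrite !norm2L_sqr// [leRHS]addrC.
Qed.

Lemma blockwise_lambda_le1 (i0 : 'I_n) : lambda <= 1.
Proof. exact: (strong_convexity_le1 L_gt0 U0_diff U0_lipschitz U0_convex i0).
  Qed.

(** In the sum over m, block j moves in exactly one term: the separable part gives M - 1 unchanged
    copies of Um j, and convexity splits the last one into shares 1 - t and t. *)
Lemma potential_mix_block_le (x y : 'rV[R]_n) (t : R) :
  0 <= t -> t <= lambda -> t <= 1 ->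
  \sum_m potential U0 Um (mix_block b t m x y) <=
  (M%:R - t) * potential U0 Um x + t * potential U0 Um y.
Proof.
move=> t0 tl t1.
have H0 := sum_mix_block_le L_gt0 U0_diff U0_lipschitz U0_convex x y t0 tl.
have subE m j : submxrow (mix_block b t m x y) j =
    if j == m then t *: submxrow y j + (1 - t) *: submxrow x j else submxrow x
      j.
  apply/rowP => k; rewrite !mxE tagnat.Rank1K; case: ifP => _; rewrite !mxE//.
  by rewrite addrC.
rewrite /potential big_split/=.
rewrite [leRHS](_ : _ = ((M%:R - t) * U0 x + t * U0 y) +
  ((M%:R - t) * (\sum_m Um (submxrow x m)) + t * (\sum_m Um (submxrow y m))));
    last by ring.
apply: lerD => //.
rewrite exchange_big/= !mulr_sumr -big_split/=; apply: ler_sum => j _.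
rewrite (bigD1 j)//= subE eqxx (eq_bigr (fun _ => Um (submxrow x j))); last
  first.
  by move=> m mj; rewrite subE eq_sym (negbTE mj).
rewrite sumr_const cardC1 card_ord.
have : Um (t *: submxrow y j + (1 - t) *: submxrow x j) <=
    t * Um (submxrow y j) + (1 - t) * Um (submxrow x j).
  by apply: convex_functionE; [exact: (bcs_convex assumption)|rewrite t0 t1].
have MP : M.-1%:R = M%:R - 1 :> R.
  by rewrite -[in RHS](@prednK M) ?(leq_ltn_trans (leq0n j))// -natr1 addrK.
rewrite -[_ *+ M.-1]mulr_natl MP; lra.
Qed.

End assumption.

(** * Continuity of finite convex functions, used for the measurability and local boundedness of the
    potential *)

Section convex_continuous.
Context {R : realType} (n : nat).
Variables (f : 'rV[R]_n -> R).
Hypothesis fc : forall (x y : 'rV[R]_n) (s : R), 0 <= s <= 1 ->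
  f (s *: x + (1 - s) *: y) <= s * f x + (1 - s) * f y.

(* Halving splits a displacement into a coordinate direction and the rest:
   [x + v = 1/2 (x + 2 v_j e_j) + 1/2 (x + 2 (v - v_j e_j))]. *)
Lemma convex_upper_lipschitz (x : 'rV[R]_n) : exists C e : R,
  [/\ 0 <= C, 0 < e & forall r (v : 'rV[R]_n),
    0 <= r <= e -> (forall i, `|v 0 i| <= r) ->
    f (x + v) - f x <= C * r].
Proof.
suff /(_ n)[C [e [C0 e0 H]]] : forall k, exists C e : R, [/\ 0 <= C, 0 < e &
  forall r (v : 'rV[R]_n),
    0 <= r <= e -> (forall i, `|v 0 i| <= r) ->
    (forall i : 'I_n, (k <= i)%N -> v 0 i = 0) -> f (x + v) - f x <= C * r].
  exists C, e; split => // r v re vr; apply: H => // i.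
  by rewrite leqNgt ltn_ord.
elim=> [|k [C [e [C0 e0 H]]]].
  exists 0, 1; split => // r v _ _ v0.
  rewrite mul0r (_ : v = 0) ?addr0 ?subrr//.
  by apply/rowP => i; rewrite v0// mxE.
have [kn|nk] := ltnP k n; last first.
  exists C, e; split => // r v re vr v0; apply: H => // i ki.
  by move: (ltn_ord i); rewrite ltnNge (leq_trans nk ki).
pose j := Ordinal kn; pose ej : 'rV[R]_n := delta_mx 0 j.
pose c := Num.max `|f (x + ej) - f x| `|f (x - ej) - f x|.
(* Halving doubles the displacements, hence the halved radius; the minimum with 1 keeps 2 v_j in
   [-1, 1], where convexity between x and x + e_j or x - e_j applies. The two bounds, C (2 r) and c
   (2 r), are then averaged. *)
exists (C + c), (Num.min e 1 / 2); split.
- by rewrite addr_ge0// le_max normr_ge0.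
- by rewrite divr_gt0// lt_min e0 ltr01.
move=> r v /andP[r0 re] vr v0.
have r2e : 2 * r <= e by move: re; rewrite ler_pdivlMr// mulrC le_min =>
  /andP[].
have r21 : 2 * r <= 1 by move: re; rewrite ler_pdivlMr// mulrC le_min =>
  /andP[].
pose w : 'rV[R]_n := \row_i (if i == j then 0 else 2 * v 0 i).
have Hw : f (x + w) - f x <= C * (2 * r).
  apply: H; first by rewrite mulr_ge0.
    move=> i; rewrite mxE; case: ifP => _; first by rewrite normr0 mulr_ge0.
    by rewrite normrM ger0_norm// ler_pM2l.
  move=> i ki; rewrite mxE; case: ifPn => // ij; rewrite v0 ?mulr0//.
  by rewrite ltn_neqAle ki andbT; apply: contra ij => /eqP ki';
    apply/eqP/val_inj.
have c1 : f (x + ej) - f x <= c by rewrite le_max ler_norm.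
have c2 : f (x - ej) - f x <= c by rewrite le_max ler_norm orbT.
have Hj : f (x + (2 * v 0 j) *: ej) - f x <= c * (2 * r).
  have vj := vr j; have c0 : 0 <= c by rewrite le_max normr_ge0.
  have [vj0|vj0] := leP 0 (v 0 j).
    rewrite ger0_norm// in vj.
    have s01 : 0 <= 2 * v 0 j <= 1 by lra.
    have := fc (x + ej) x s01.
    rewrite (_ : _ *: (x + ej) + _ = x + (2 * v 0 j) *: ej); last first.
      by apply/rowP => i; rewrite !mxE; ring.
    by nra.
  rewrite ltr0_norm// in vj.
  have s01 : 0 <= - (2 * v 0 j) <= 1 by lra.
  have := fc (x - ej) x s01.
  rewrite (_ : _ *: (x - ej) + _ = x + (2 * v 0 j) *: ej); last first.
    by apply/rowP => i; rewrite !mxE; ring.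
  by nra.
have h01 : 0 <= (2^-1 : R) <= 1 by lra.
have := fc (x + (2 * v 0 j) *: ej) (x + w) h01.
rewrite (_ : _ *: _ + _ = x + v); first by lra.
apply/rowP => i; rewrite !mxE eqxx/=.
by case: ifP => [/eqP ->|_]; rewrite ?mulr1n ?mulr0n; field.
Qed.

(** The lower bound comes from the upper one by reflection: x is the midpoint of y and 2 x - y. *)
Lemma convex_continuous : continuous (f : 'rV[R]_n -> R^o).
Proof.
move=> x; have [C [e [C0 e0 H]]] := convex_upper_lipschitz x.
apply/(@cvgrPdist_le _ R^o _ _ (nbhs_filter (x : 'rV[R]_n))) => /= eps eps0.
pose r := Num.min e (eps / (C + 1)).
have r0 : 0 < r by rewrite lt_min e0 divr_gt0// ltr_wpDl.
have re : r <= e by rewrite ge_min lexx.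
have rC : C * r <= eps.
  have : r <= eps / (C + 1) by rewrite ge_min lexx orbT.
  by rewrite ler_pdivlMr ?ltr_wpDl//; nra.
near=> y.
have yx i : `|(y - x) 0 i| <= r.
  rewrite !mxE distrC ltW//.
  suff [_ /(_ 0 i)] : ball (x : 'rV[R]_n) r y by [].
  by near: y; exact: nbhsx_ballx.
have r0e : 0 <= r <= e by rewrite ltW.
have H1 := H r (y - x) r0e yx.
have H2 : f (x + (x - y)) - f x <= C * r.
  by apply: H => // i; have := yx i; rewrite !mxE distrC.
have h01 : 0 <= (2^-1 : R) <= 1 by lra.
have := fc y (x + (x - y)) h01.
rewrite (_ : _ *: _ + _ = x); last by apply/rowP => i; rewrite !mxE; field.
move: H1; rewrite addrCA subrr addr0 => H1 H3.
rewrite ler_norml; apply/andP; split; lra.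
Unshelve. all: by end_near.
Qed.

End convex_continuous.

(** * Integration against a density and the Brascamp-Lieb inequality for the Gibbs measure *)

Section density.
Context d (T : measurableType d) (R : realType).
Variables (nu : {finite_measure set T -> \bar R})
  (mu : {sigma_finite_measure set T -> \bar R}) (f : T -> R).
Hypothesis mf : measurable_fun setT f.
Hypothesis fE : forall A, measurable A -> nu A = (\int[mu]_(x in A) (f x)%:E)%E.

Lemma density_dominates : nu `<< mu.
Proof.
apply/null_content_dominatesP => A mA muA0.
rewrite fE//; apply: null_set_integral => //.
by apply/measurable_EFinP; exact: measurable_funTS.
Qed.

(** The given density has the same integrals over measurable sets as the Radon-Nikodym derivative,
    so they agree almost everywhere and the change of variables carries over. *)
Lemma ge0_integral_density (g : T -> \bar R) : measurable_fun setT g ->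
  (forall x, 0 <= g x)%E -> (\int[nu]_x g x = \int[mu]_x (g x * (f x)%:E))%E.
Proof.
move=> mg g0.
rewrite -(Radon_Nikodym_SigmaFinite.change_of_variables density_dominates)//.
apply: ae_eq_integral => //.
- apply: emeasurable_funM => //.
  exact: measurable_int (Radon_Nikodym_SigmaFinite.f_integrable
    density_dominates).
- by apply: emeasurable_funM => //; exact/measurable_EFinP.
apply: ae_eqe_mul2l; apply: integral_ae_eq => //.
- exact: Radon_Nikodym_SigmaFinite.f_integrable density_dominates.
- exact/measurable_EFinP.
- move=> A _ mA; rewrite -fE//.
  by rewrite -Radon_Nikodym_SigmaFinite.f_integral//; exact: density_dominates.
Qed.

End density.

Section bounded_integrable.
Context d (T : measurableType d) (R : realType) (P : probability T R).

Lemma bounded_integrable (D : R) (u : T -> R) : measurable_fun setT u ->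
  (forall x, `|u x| <= D) -> P.-integrable setT (EFin \o u).
Proof.
move=> mu uD; apply: measurable_bounded_integrable => //.
  by rewrite (le_lt_trans (probability_le1 P measurableT))// ltry.
exists D; split; first exact: num_real.
by move=> r Dr x _; rewrite /= (le_trans (uD x))// ltW.
Qed.

Lemma bounded_expR_integrable (D : R) (u : T -> R) : measurable_fun setT u ->
  (forall x, `|u x| <= D) -> P.-integrable setT (EFin \o (fun x => expR (u x))).
Proof.
move=> mu uD; apply: (@bounded_integrable (expR D)).
  exact: measurableT_comp.
move=> x; rewrite ger0_norm ?expR_ge0// ler_expR.
exact: le_trans (ler_norm _) (uD x).
Qed.

Lemma Rintegral_probability_cst (c : R) : \int[P]_x c = c.
Proof. by rewrite Rintegral_cst// [X in fine X]probability_setT mulr1. Qed.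

Lemma bounded_expR_integral_gt0 (D : R) (u : T -> R) : measurable_fun setT u ->
  (forall x, `|u x| <= D) -> 0 < \int[P]_x expR (u x).
Proof.
move=> mu uD; apply: (@lt_le_trans _ _ (\int[P]_x (expR (- D)))).
  by rewrite Rintegral_probability_cst expR_gt0.
apply: le_Rintegral => //.
- exact: finite_measure_integrable_cst.
- exact: bounded_expR_integrable uD.
- by move=> x _; rewrite ler_expR; have := uD x; rewrite ler_norml => /andP[].
Qed.

End bounded_integrable.

Section gibbs_measure.
Context {R : realType} {M : nat} (d : 'I_M -> nat).
Local Notation n := (\sum_m d m)%N.
Local Notation b := (@tagnat.sig1 M d).

Lemma continuous_measurable_rV k (f : 'rV[R]_k -> R) :
  continuous (f : _ -> R^o) -> measurable_fun setT f.
Proof.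
move=> cf; apply: (measurability (@RGenOpens.G R)).
  exact: RGenOpens.measurableE.
move=> _ [_ [a [c ->]] <-]; rewrite setTI; apply: open_measurable_rV.
by move/continuousP : cf; apply; exact: interval_open.
Qed.

Lemma cube_bounded k (f : 'rV[R]_k -> R) (N : R) : continuous (f : _ -> R^o) ->
  exists C, forall x, cube k N x -> `|f x| <= C.
Proof.
move=> cf; have ccube : compact (cube k N).
  by apply: (@rV_compact R k (fun=> `[- N, N]%classic)) => i; exact:
    segment_compact.
have : compact ((f : _ -> R^o) @` cube k N).
  by apply: continuous_compact => //; exact: continuous_subspaceT.
move/compact_bounded => [C [Creal HC]]; exists (C + 1) => x Nx.
by apply: (HC (C + 1)); [rewrite ltrDl|exists x].
Qed.

Lemma cvg_integral_cube k (P : probability 'rV[R]_k R) (phi : 'rV[R]_k -> R) (C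
  : R) :
  measurable_fun setT phi -> (forall x, 0 <= phi x <= C) ->
  \int[P]_x (phi x * \1_(cube k N%:R) x) @[N --> \oo] --> \int[P]_x phi x.
Proof.
move=> mphi phiC; have C0 : 0 <= C.
  by have /andP[a0 aC] := phiC 0; exact: le_trans aC.
have phi0 x : 0 <= phi x by case/andP: (phiC x).
have mN N : measurable_fun setT (fun x => phi x * \1_(cube k N%:R) x).
  apply: measurable_funM => //; apply: measurable_indic; exact: measurable_cube.
have iphi : P.-integrable setT (EFin \o phi).
  apply: (@bounded_integrable _ _ _ P C) => // x.
  by rewrite ger0_norm//; case/andP: (phiC x).
apply: fine_cvg; rewrite fineK; last exact: integrable_fin_num.
have [] // := @dominated_convergence _ _ _ P _ measurableT
  (fun N x => (phi x * \1_(cube k N%:R) x)%:E) (EFin \o phi) (EFin \o phi).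
- by move=> N; exact/measurable_EFinP.
- exact/measurable_EFinP.
- apply/aeW => x _; apply: cvg_near_cst.
  pose B := \sum_i `|x 0 i|.
  have [N0 _ HN0] := nbhs_infty_ger B.
  exists N0 => // N /= N0N; rewrite indicE mem_set ?mulr1// => i /=.
  rewrite in_itv/= -ler_norml; apply: (@le_trans _ _ B).
    by rewrite /B (bigD1 i)//= lerDl sumr_ge0.
  by apply: HN0.
- apply/aeW => x N _ /=; rewrite lee_fin ger0_norm ?mulr_ge0//.
  by rewrite indicE; case: (_ \in _); rewrite ?mulr1 ?mulr0.
Qed.

Variables (U0 : 'rV[R]_n -> R) (Um : forall m, 'rV[R]_(d m) -> R).
Variables (L : 'I_M -> R) (lambda : R) (pi : probability 'rV[R]_n R).
Hypothesis L_gt0 : forall m, 0 < L m.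
Hypothesis assumption : blockwise_convex_smooth U0 Um L lambda.
Hypothesis pi_density :
  has_lebesgue_density pi (fun x => expR (- potential U0 Um x)).
Local Notation U := (potential U0 Um).

Lemma continuous_potential : continuous (U : _ -> R^o).
Proof.
have cU0 : continuous (U0 : _ -> R^o).
  by move=> x; apply: differentiable_continuous; case: assumption => _ [].
have cUm : continuous ((fun x => \sum_m Um (submxrow x m)) : 'rV[R]_n -> R^o).
  apply: convex_continuous => y z s s01.
  rewrite !mulr_sumr -big_split/=; apply: ler_sum => m _.
  rewrite (_ : submxrow _ m = s *: submxrow y m + (1 - s) *: submxrow z m).
    by apply: convex_functionE => //; exact: (bcs_convex assumption).
  by apply/rowP => i; rewrite !mxE.
by move=> x; exact: (cvgD (cU0 x) (cUm x)).
Qed.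

Let mU : measurable_fun setT U.
Proof. by apply: continuous_measurable_rV; exact: continuous_potential. Qed.

Lemma gibbs_integral (g : 'rV[R]_n -> R) : measurable_fun setT g ->
  (forall x, 0 <= g x) ->
  \int[lebesgue_rV n]_x (g x * expR (- U x)) = \int[pi]_x g x.
Proof.
move=> mg g0; rewrite /Rintegral; congr fine; apply/esym.
rewrite (ge0_integral_density (f := fun x => expR (- U x)) (mu := lebesgue_rV
  n))//.
- by apply: measurableT_comp => //; apply: measurableT_comp.
- exact/measurable_EFinP.
Qed.

(** The third condition on g says that g m ignores moves in block m. The inequality is first
    obtained with all functions cut off to a cube; on the right the cutoff is dropped by
    monotonicity, so only the two integrals on the left need the limit N to infinity. *)
Lemma gibbs_brascamp_lieb (t B : R) (g : 'I_M -> 'rV[R]_n -> R) :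
  (0 < M)%N -> 0 < t -> t < 1 -> t <= lambda ->
  (forall m, measurable_fun setT (g m)) -> (forall m x, `|g m x| <= B) ->
  (forall m x y, g m (mix_block b t m x y) = g m x) ->
  (M%:R - t) * ln (\int[pi]_x expR ((\sum_m g m x) / (M%:R - t))) <=
  \sum_m ln (\int[pi]_x expR (g m x)).
Proof.
move=> M0 t0 t1 tl mg gB gmix.
have M1 : (1 : R) <= M%:R by rewrite ler1n.
have Mt : 0 < M%:R - t by rewrite subr_gt0 (lt_le_trans t1).
(* The zero exponent stands for G = exp(-U); its integral tends to pi(R^n) = 1, so its logarithm
   disappears in the limit. *)
pose z : 'rV[R]_n -> R := cst 0.
have mz : measurable_fun setT z by exact: measurable_cst.
have B0 : 0 <= B by apply: (le_trans _ (gB (Ordinal M0) 0)).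
pose s x := (\sum_m g m x) / (M%:R - t).
have ms : measurable_fun setT s.
  by apply: measurable_funM => //; apply: measurable_sum.
pose C := B * M%:R / (M%:R - t).
have sC x : `|s x| <= C.
  rewrite /s /C normrM [`|_^-1|]gtr0_norm ?invr_gt0// ler_pM2r ?invr_gt0//.
  apply: (le_trans (ler_norm_sum _ _ _)).
  by rewrite -[M in _ * M%:R]card_ord mulr_natr -sumr_const; apply: ler_sum.
pose cubeint (u : 'rV[R]_n -> R) (N : nat) := \int[pi]_x (expR (u x) * \1_(cube
  n N%:R) x).
have cube_ineq N : (cubeint s N) `^ (M%:R - t) * (cubeint z N) `^ t <=
    \prod_m \int[pi]_x expR (g m x).
  pose I1 : 'rV[R]_n -> R := \1_(cube n N%:R).
  have mI : measurable_fun setT I1 by apply: measurable_indic; exact: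
    measurable_cube.
  have [D UD] := cube_bounded N%:R continuous_potential.
  pose K := expR (`|D| + B + C).
  pose F (u : 'rV[R]_n -> R) x := expR (u x) * I1 x * expR (- U x).
  have Fb (u : 'rV[R]_n -> R) : measurable_fun setT u ->
      (forall x, `|u x| <= B + C) -> bounded_in (cube n N%:R) K (F u).
    move=> mu uBC; split.
    - apply: measurable_funM; last first.
        by apply: measurableT_comp => //; apply: measurableT_comp.
      by apply: measurable_funM => //; exact: measurableT_comp.
    - move=> x; rewrite /F /I1 indicE; have [xN|xN] := boolP (x \in _); last
      first.
        by rewrite mulr0 mul0r lexx expR_ge0.
      rewrite mulr1 -expRD expR_ge0/= ler_expR -addrA addrC.
      apply: lerD; first by rewrite (le_trans (ler_norm _)).
      move/set_mem : xN => /UD UxD.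
      by rewrite (le_trans (ler_norm _))// normrN (le_trans UxD)// ler_norm.
    - move=> x; rewrite /F /I1 indicE; have [/set_mem//|_] := boolP (x \in _).
      by rewrite mulr0 mul0r eqxx.
  have C0 : 0 <= C by rewrite (le_trans _ (sC 0)).
  have Ig (u : 'rV[R]_n -> R) : measurable_fun setT u ->
      \int[lebesgue_rV n]_x F u x = cubeint u N.
    move=> mu; rewrite /F gibbs_integral//.
      by apply: measurable_funM => //; exact: measurableT_comp.
    by move=> x; rewrite mulr_ge0 ?expR_ge0// /I1 indicE.
  have sBC x : `|s x| <= B + C by rewrite (le_trans (sC x))// lerDr.
  have cBC x : `|z x| <= B + C by rewrite normr0 addr_ge0.
  have gBC m x : `|g m x| <= B + C by rewrite (le_trans (gB m x))// lerDl.
  have key x y : F s x `^ (M%:R - t) * F z y `^ t <=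
      \prod_m F (g m) (mix_block b t m x y).
    have prod0 : 0 <= \prod_m F (g m) (mix_block b t m x y).
      by apply: prodr_ge0 => m _; rewrite /F !mulr_ge0 ?expR_ge0// /I1 indicE.
    rewrite {1 2}/F /I1 !indicE.
    have [/set_mem xN|_] := boolP (x \in _); last first.
      by rewrite mulr0 mul0r powR0 ?mul0r// gt_eqF.
    have [/set_mem yN|_] := boolP (y \in _); last first.
      by rewrite mulr0 mul0r [X in _ * X]powR0 ?mulr0// gt_eqF.
    (* Each coordinate of the mixed point is x_i or a convex combination of x_i and y_i, so the
       point stays in the cube and its indicator is 1. *)
    rewrite (eq_bigr (fun m => expR (g m x - U (mix_block b t m x y)))); last
      first.
      move=> m _; rewrite /F gmix /I1 indicE mem_set ?mulr1 -?expRD//.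
      move=> i /=; have := xN i; have := yN i; rewrite /= !in_itv/= mxE.
      move=> /andP[y1 y2] /andP[x1 x2]; case: ifP => _; last by rewrite x1 x2.
      by apply/andP; split; nra.
    rewrite -expR_sum !mulr1 -!expRD -!expRM -expRD ler_expR.
    rewrite sumrB add0r.
    have := potential_mix_block_le L_gt0 assumption x y (ltW t0) tl (ltW t1).
    have -> : (s x - U x) * (M%:R - t) = \sum_m g m x - (M%:R - t) * U x.
      by rewrite mulrBl /s divfK ?gt_eqF// [U x * _]mulrC.
    lra.
  have := blockwise_prekopa_leindler t0 t1 (Fb _ ms sBC) (Fb _ mz cBC)
    (fun m => Fb _ (mg m) (gBC m)) key.
  rewrite !Ig// => /le_trans; apply.
  apply: ler_prod => m _; rewrite Ig//; apply/andP; split.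
    by apply: Rintegral_ge0 => x _; rewrite mulr_ge0 ?expR_ge0// /I1 indicE.
  apply: le_Rintegral => //.
  - apply: (@bounded_integrable _ _ _ pi (expR B)) => [|x].
      by apply: measurable_funM => //; exact: measurableT_comp.
    rewrite ger0_norm ?mulr_ge0 ?expR_ge0 /I1 ?indicE//.
    apply: (@le_trans _ _ (expR (g m x))).
      by case: (_ \in _); rewrite ?mulr1 ?mulr0 ?expR_ge0.
    by rewrite ler_expR (le_trans (ler_norm _)).
  - exact: (bounded_expR_integrable pi (mg m) (gB m)).
  - move=> x _; rewrite /I1 indicE.
    by case: (_ \in _); rewrite ?mulr1 ?mulr0 ?expR_ge0.
have cvgI (u : 'rV[R]_n -> R) (D : R) : measurable_fun setT u ->
    (forall x, `|u x| <= D) -> cubeint u N @[N --> \oo] --> \int[pi]_x expR (u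
      x).
  move=> mu uD; apply: (@cvg_integral_cube _ pi (fun x => expR (u x)) (expR D)).
    exact: measurableT_comp.
  by move=> x; rewrite expR_ge0 ler_expR (le_trans (ler_norm _)).
have ca := cvgI s C ms sC.
have I0 := bounded_expR_integral_gt0 pi ms sC.
have c0 x : `|z x| <= 0 by rewrite normr0.
have := cvgI z 0 mz c0.
have -> : \int[pi]_x expR (z x) = 1.
  by under eq_Rintegral do rewrite expR0; exact: Rintegral_probability_cst.
move=> cb.
have a0 : \forall N \near \oo, 0 < cubeint s N by exact: cvgr_gt ca _ I0.
have b0 : \forall N \near \oo, 0 < cubeint z N by exact: cvgr_gt cb _ ltr01.
have clim : (M%:R - t) * ln (cubeint s N) + t * ln (cubeint z N) @[N --> \oo]
    --> (M%:R - t) * ln (\int[pi]_x expR (s x)) + t * ln 1.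
  apply: cvgD; apply: cvgMl_tmp.
    exact: (cvg_comp _ _ ca (continuous_ln I0)).
  exact: (cvg_comp _ _ cb (continuous_ln ltr01)).
have -> : (M%:R - t) * ln (\int[pi]_x expR (s x)) =
    (M%:R - t) * ln (\int[pi]_x expR (s x)) + t * ln 1.
  by rewrite ln1 mulr0 addr0.
have cl := cvg_lim _ clim.
rewrite -cl//; apply: limr_le; first by apply/cvg_ex; eexists; exact: clim.
near=> N.
have aN : 0 < cubeint s N by near: N.
have bN : 0 < cubeint z N by near: N.
rewrite -ler_expR expRD [_ * ln (cubeint s N)]mulrC [_ * ln (cubeint _ N)]mulrC.
have := cube_ineq N; rewrite /powR !gt_eqF// [_ * ln (cubeint s N)]mulrC [_ *
  ln (cubeint _ N)]mulrC => /le_trans; apply.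
rewrite expR_sum; apply: ler_prod => m _.
have gI := bounded_expR_integral_gt0 pi (mg m) (gB m).
by rewrite lnK ?posrE// lexx ltW.
Unshelve. all: by end_near.
Qed.

End gibbs_measure.

(** * Relative entropy: the Donsker-Varadhan inequality and truncated log-densities *)

Lemma measurable_lne {R : realType} : measurable_fun setT (@lne R).
Proof.
rewrite (_ : @lne R = fun x => if (x <= 0)%E then -oo%E else
    if x == +oo%E then +oo%E else (ln (fine x))%:E); last first.
  by apply/funext => -[r| |] /=; rewrite ?lee_fin ?leye_eq ?leNye.
apply: measurable_fun_ifT => //.
  exact: measurable_fun_lee.
apply: measurable_fun_ifT => //.
  exact: measurable_fun_eqe.
by apply/measurable_EFinP; apply: measurableT_comp => //; exact:
  measurableT_comp.
Qed.

Lemma ln_clamp_le {R : realType} (N : nat) (u : R) :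
  `|ln (Num.max (Num.min u (expR N%:R)) (expR (- N%:R)))| <= N%:R.
Proof.
rewrite ler_norml; apply/andP; split.
  rewrite -[leLHS]expRK ler_ln ?posrE ?expR_gt0//.
    by rewrite le_max lexx orbT.
  by rewrite lt_max expR_gt0 orbT.
rewrite -[leRHS]expRK ler_ln ?posrE ?expR_gt0//.
  by rewrite ge_max ge_min lexx orbT/= ler_expR; have := ler0n R N; lra.
by rewrite lt_max expR_gt0 orbT.
Qed.

Section relative_entropy.
Context d (T : measurableType d) (R : realType) (mu nu : probability T R).

(* [h] is a density of [mu] with respect to [nu]; [k] is a positive version of
   it, which agrees with [h] only [mu]-almost everywhere. *)
Record entropy_density (h k : T -> R) : Prop := EntropyDensity {
  ed_measurable : measurable_fun setT h ;
  ed_ge0 : forall x, 0 <= h x ;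
  ed_integral : (\int[nu]_x (h x)%:E = 1)%E ;
  ed_measurable_pos : measurable_fun setT k ;
  ed_gt0 : forall x, 0 < k x ;
  ed_ae : {ae mu, forall x, h x = k x} ;
  ed_div : forall phi : T -> R, measurable_fun setT phi ->
    (forall x, 0 <= phi x) ->
    (\int[mu]_x (phi x / k x)%:E <= \int[nu]_x (phi x)%:E)%E ;
  ed_KL : (KL mu nu = \int[mu]_x (ln (k x))%:E)%E }.

(** Take for [k] the density [h] with its zeros replaced by 1; they form a mu-null set. [ed_div] is
    only an inequality because nu may charge that set, where phi contributes to the right side
    alone. *)
Lemma entropy_density_exists : mu `<< nu -> exists h k, entropy_density h k.
Proof.
move=> munu.
pose f := Radon_Nikodym_SigmaFinite.f mu nu.
have f0 : forall x, (0 <= f x)%E := Radon_Nikodym_SigmaFinite.f_ge0 munu.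
have fK x : (fine (f x))%:E = f x.
  by rewrite fineK//; exact: Radon_Nikodym_SigmaFinite.f_fin_num.
have fi := Radon_Nikodym_SigmaFinite.f_integrable munu.
have mf : measurable_fun setT f := measurable_int nu fi.
pose h x := fine (f x).
have mh : measurable_fun setT h by exact: measurableT_comp.
have h0 x : 0 <= h x by rewrite fine_ge0.
have hE A : measurable A -> mu A = (\int[nu]_(x in A) (h x)%:E)%E.
  move=> mA; rewrite (Radon_Nikodym_SigmaFinite.f_integral munu mA).
  by apply: eq_integral => x _; rewrite fK.
pose k x := if 0 < h x then h x else 1.
have mk : measurable_fun setT k.
  by apply: measurable_fun_ifT => //; exact: measurable_fun_ltr.
have k0 x : 0 < k x by rewrite /k; case: ifPn.
have mle : measurable [set x | h x <= 0].
  have := measurable_fun_ler mh (measurable_cst (0 : R)).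
  by move=> /(_ measurableT [set true]); rewrite setTI; exact.
have hk : {ae mu, forall x, h x = k x}.
  exists [set x | h x <= 0]; split => //.
    rewrite hE//; apply: integral0_eq => x /= hx0.
    by congr EFin; apply/eqP; rewrite eq_le hx0 h0.
  move=> x /= hx; rewrite leNgt; apply/negP => hx0; apply: hx.
  by rewrite /k hx0.
exists h, k; split => //.
- by rewrite -hE// probability_setT.
- move=> phi mphi phi0.
  rewrite (ge0_integral_density mh hE); last 2 first.
  + apply/measurable_EFinP; apply: measurable_funM => //.
    rewrite (_ : (fun _ => _) = fun x => k x `^ (-1)).
      exact: (measurableT_comp (measurable_powR _)).
    by apply/funext => x; rewrite powR_inv1// ltW.
  + by move=> x; rewrite lee_fin divr_ge0// ltW.
  apply: ge0_le_integral => //.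
  + by move=> x _; rewrite -EFinM lee_fin mulr_ge0// divr_ge0// ltW.
  + apply/measurable_EFinP; apply: measurable_funM => //.
    apply: measurable_funM => //.
    rewrite (_ : (fun _ => _) = fun x => k x `^ (-1)).
      exact: (measurableT_comp (measurable_powR _)).
    by apply/funext => x; rewrite powR_inv1// ltW.
  + by apply/measurable_EFinP.
  + move=> x _; rewrite -EFinM lee_fin /k; case: ifPn => hx.
      by rewrite divfK// gt_eqF.
    rewrite divr1 (_ : h x = 0) ?mulr0//.
    by apply/eqP; rewrite eq_le h0 andbT leNgt.
- rewrite /KL; case: pselect => // munu'.
  apply: ae_eq_integral => //.
  + apply: (measurableT_comp measurable_lne).
    by apply: (measurable_int nu); apply: Radon_Nikodym_integrable; exact: munu.
  + by apply/measurable_EFinP; exact: measurableT_comp.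
  have E1 : ae_eq mu setT f (Radon_Nikodym (charge_of_finite_measure mu) nu).
    apply: (null_dominates_ae_eq measurableT munu).
    exact: ae_eq_Radon_Nikodym_SigmaFinite.
  near=> x => _.
  have hkx : h x = k x by near: x.
  have <- : f x = Radon_Nikodym (charge_of_finite_measure mu) nu x.
    by have : setT x by []; near: x.
  by rewrite -fK -/(h x) hkx lne_EFin.
Unshelve. all: by end_near. Qed.

Variables (h k : T -> R) (hk : entropy_density h k).

Let mln : measurable_fun setT (fun x => ln (k x)).
Proof. by apply: measurableT_comp => //; exact: (ed_measurable_pos hk). Qed.

Let k0 x : 0 < k x := ed_gt0 hk x.

Let p x : R := Num.max (ln (k x)) 0.
Let q x : R := Num.max (- ln (k x)) 0.

Let mp : measurable_fun setT p.
Proof. exact: measurable_maxr. Qed.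

Let mq : measurable_fun setT q.
Proof. by apply: measurable_maxr => //; exact: measurableT_comp. Qed.

Let p0 x : 0 <= p x. Proof. by rewrite le_max lexx orbT. Qed.
Let q0 x : 0 <= q x. Proof. by rewrite le_max lexx orbT. Qed.

Let pBq x : p x - q x = ln (k x).
Proof.
rewrite /p /q; case: (lerP 0 (ln (k x))) => lk; case: (lerP 0 (- ln (k x))) =>
  lk'; lra.
Qed.

Let pDq x : `|ln (k x)| = p x + q x.
Proof.
rewrite /p /q; case: (ger0P (ln (k x))) => lk; case: (lerP 0 (- ln (k x))) =>
  lk'; lra.
Qed.

(** The negative part of ln k is at most 1 / k, whose mu-integral is at most the nu-mass of the
    space. Hence the integral defining the entropy is never of the form oo - oo. *)
Let int_q_le1 : (\int[mu]_x (q x)%:E <= 1)%E.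
Proof.
apply: (@le_trans _ _ (\int[mu]_x (1 / k x)%:E)%E).
  apply: ge0_le_integral => //.
  - by move=> x _; rewrite lee_fin.
  - exact/measurable_EFinP.
  - apply/measurable_EFinP; apply: measurable_funM => //.
    rewrite (_ : (fun _ => _) = fun x => k x `^ (-1)).
      by apply: (measurableT_comp (measurable_powR _)); exact:
        ed_measurable_pos hk.
    by apply/funext => x; rewrite powR_inv1// ltW.
  - move=> x _; rewrite lee_fin div1r ge_max invr_ge0 (ltW (k0 x)) andbT.
    by rewrite -lnV ?posrE// ltW// ln_sublinear// invr_gt0.
apply: (le_trans (ed_div hk (phi := fun=> 1) _ _)) => //.
rewrite integral_cst// [X in (_ * X)%E]probability_setT mule1//.
Qed.

Let KLE : (KL mu nu = \int[mu]_x (p x)%:E - \int[mu]_x (q x)%:E)%E.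
Proof.
rewrite (ed_KL hk) integralE; congr (_ - _)%E; apply: eq_integral => x _.
  by rewrite funeposE -EFin_max.
by rewrite funenegE -EFinN -EFin_max.
Qed.

Let q_fin : (\int[mu]_x (q x)%:E \is a fin_num)%E.
Proof.
rewrite ge0_fin_numE; first by rewrite (le_lt_trans int_q_le1)// ltry.
by apply: integral_ge0 => x _; rewrite lee_fin.
Qed.

Lemma ln_density_integrable : (KL mu nu < +oo)%E ->
  mu.-integrable setT (EFin \o (fun x => ln (k x))).
Proof.
rewrite KLE => KLoo.
have poo : (\int[mu]_x (p x)%:E < +oo)%E.
  move: KLoo; rewrite -(fineK q_fin); case: (\int[mu]_x (p x)%:E)%E => // r _.
  exact: ltry.
apply/integrableP; split; first exact/measurable_EFinP.
rewrite (_ : (\int[mu]_x _ = \int[mu]_x ((p x)%:E + (q x)%:E))%E).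
  rewrite ge0_integralD//.
  - by rewrite lte_add_pinfty// -ge0_fin_numE// integral_ge0// => x _; rewrite
    lee_fin.
  - by move=> x _; rewrite lee_fin.
  - exact/measurable_EFinP.
  - by move=> x _; rewrite lee_fin.
  - exact/measurable_EFinP.
by apply: eq_integral => x _ /=; rewrite -EFinD pDq.
Qed.

(** Integrate ln u <= u - 1 at u = e^g / (Z k) against mu, with Z the nu-integral of e^g: by
    [ed_div] the mu-integral of u is at most 1. *)
Lemma donsker_varadhan (D : R) (g : T -> R) : measurable_fun setT g ->
  (forall x, `|g x| <= D) ->
  ((\int[mu]_x g x)%:E <= KL mu nu + (ln (\int[nu]_x expR (g x)))%:E)%E.
Proof.
move=> mg gD; have [KLoo|] := ltP (KL mu nu) +oo%E; last first.
  by rewrite leye_eq => /eqP ->; rewrite addye// leey.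
have li := ln_density_integrable KLoo.
set Z := \int[nu]_x expR (g x).
have Z0 : 0 < Z by exact: bounded_expR_integral_gt0 gD.
have eg := bounded_expR_integrable nu mg gD.
have gi := bounded_integrable mu mg gD.
have ZE : (\int[nu]_x (expR (g x))%:E = Z%:E)%E.
  by rewrite /Z /Rintegral fineK//; exact: integrable_fin_num.
have mphi : measurable_fun setT (fun x => expR (g x) / k x).
  apply: measurable_funM; first exact: measurableT_comp.
  rewrite (_ : (fun _ => _) = fun x => k x `^ (-1)).
    by apply: (measurableT_comp (measurable_powR _)); exact: ed_measurable_pos
      hk.
  by apply/funext => x; rewrite powR_inv1// ltW.
have phiZ : (\int[mu]_x (expR (g x) / k x)%:E <= Z%:E)%E.
  rewrite -ZE; apply: (ed_div hk); first exact: measurableT_comp.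
  by move=> x; exact: expR_ge0.
have phi0 x : 0 <= expR (g x) / k x by rewrite divr_ge0 ?expR_ge0// ltW.
have iphi : mu.-integrable setT (EFin \o (fun x => expR (g x) / k x)).
  apply/integrableP; split; first exact/measurable_EFinP.
  under eq_integral do rewrite gee0_abs ?lee_fin//.
  by rewrite (le_lt_trans phiZ)// ltry.
pose rhs x := ln (k x) + (Z^-1 * (expR (g x) / k x) + (ln Z - 1)).
have ci : mu.-integrable setT (EFin \o (fun _ : T => ln Z - 1)).
  exact: finite_measure_integrable_cst.
have zi : mu.-integrable setT (EFin \o (fun x => Z^-1 * (expR (g x) / k x))).
  rewrite (_ : EFin \o _ = fun x => Z^-1%:E * (EFin \o (fun x => (expR (g x) /
    k x)%R)) x)%E//.
  exact: integrableZl.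
have zci : mu.-integrable setT
    (EFin \o (fun x => Z^-1 * (expR (g x) / k x) + (ln Z - 1))).
  by rewrite (_ : EFin \o _ = (EFin \o (fun x => (Z^-1 * (expR (g x) / k x))%R))
    \+ (EFin \o (fun _ : T => (ln Z - 1)%R)))%E//; exact: integrableD.
have ri : mu.-integrable setT (EFin \o rhs).
  by rewrite (_ : EFin \o _ = (EFin \o (fun x => ln (k x)))
    \+ (EFin \o (fun x => (Z^-1 * (expR (g x) / k x) + (ln Z - 1))%R)))%E//;
    exact: integrableD.
have grhs x : g x <= rhs x.
  have u0 : 0 < expR (g x) / (Z * k x) by rewrite divr_gt0 ?expR_gt0// mulr_gt0.
  have : ln (1 + (expR (g x) / (Z * k x) - 1)) <= expR (g x) / (Z * k x) - 1.
    by apply: le_ln1Dx; rewrite ltrBrDl subrr.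
  rewrite addrC subrK ln_div ?posrE ?expR_gt0 ?mulr_gt0// expRK lnM ?posrE//.
  rewrite /rhs (_ : Z^-1 * _ = expR (g x) / (Z * k x)); first by lra.
  by rewrite invfM mulrCA.
have := le_Rintegral measurableT gi ri (fun x _ => grhs x).
rewrite RintegralD// RintegralD// RintegralZl//.
rewrite Rintegral_probability_cst => H.
have phiZ' : Z^-1 * \int[mu]_x (expR (g x) / k x) <= 1.
  rewrite mulrC ler_pdivrMr// mul1r -lee_fin /Rintegral fineK//.
  exact: integrable_fin_num.
rewrite (ed_KL hk) -[X in (X + _)%E]fineK; last exact: (integrable_fin_num
  measurableT li).
rewrite -EFinD lee_fin.
move: H; rewrite /Rintegral; move: phiZ'; rewrite /Rintegral; lra.
Qed.

(** It truncates [h] and not [k], because exponential integrals under nu must be controlled: [h] has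
    nu-integral 1, whereas [k] is larger on the zeros of [h]. *)
Definition log_truncation (N : nat) (x : T) : R :=
  ln (Num.max (Num.min (h x) (expR N%:R)) (expR (- N%:R))).

Lemma measurable_log_truncation N : measurable_fun setT (log_truncation N).
Proof.
apply: measurableT_comp => //; apply: measurable_maxr => //.
by apply: measurable_minr => //; exact: (ed_measurable hk).
Qed.

Lemma log_truncation_le N x : `|log_truncation N x| <= N%:R.
Proof. exact: ln_clamp_le. Qed.

(** The clamped density is at most h + e^-N. *)
Lemma log_truncation_expR N :
  \int[nu]_x expR (log_truncation N x) <= 1 + expR (- N%:R).
Proof.
have hi : nu.-integrable setT (EFin \o h).
  apply/integrableP; split; first exact/measurable_EFinP/(ed_measurable hk).
  under eq_integral do rewrite gee0_abs ?lee_fin ?(ed_ge0 hk)//.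
  by rewrite (ed_integral hk) ltry.
have ci : nu.-integrable setT (EFin \o (fun _ : T => expR (- N%:R))).
  exact: finite_measure_integrable_cst.
apply: (@le_trans _ _ (\int[nu]_x (h x + expR (- N%:R)))).
  apply: le_Rintegral => //.
  - exact: (bounded_expR_integrable nu (measurable_log_truncation N)
      (log_truncation_le N)).
  - by rewrite (_ : EFin \o _ = (EFin \o h)
      \+ (EFin \o (fun _ : T => (expR (- N%:R))%R)))%E//; exact: integrableD.
  - move=> x _; rewrite /log_truncation lnK ?posrE ?lt_max ?expR_gt0 ?orbT//.
    rewrite ge_max ge_min lerDl expR_ge0 lerDr (ed_ge0 hk)//.
rewrite RintegralD// Rintegral_probability_cst.
by rewrite /Rintegral (ed_integral hk).
Qed.

(** Lower bounds that increase to the entropy even when it is infinite: cap the positive part of ln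
    k at N and keep the whole negative part. Monotonicity is what later bounds each marginal entropy
    separately, given a bound on their sum. *)
Lemma log_truncation_approx : exists a : nat -> R,
  [/\ {homo a : i j / (i <= j)%N >-> i <= j},
      forall N, a N <= \int[mu]_x log_truncation N x &
      (a N)%:E @[N --> \oo] --> KL mu nu].
Proof.
pose pN (N : nat) x := Num.min (p x) N%:R.
have pN0 N x : 0 <= pN N x by rewrite le_min p0 ler0n.
have mpN N : measurable_fun setT (pN N) by exact: measurable_minr.
have pNi N : mu.-integrable setT (EFin \o pN N).
  apply: (@bounded_integrable _ _ _ mu N%:R) => // x.
  by rewrite ger0_norm// ge_min lexx orbT.
have qi : mu.-integrable setT (EFin \o q).
  apply/integrableP; split; first exact/measurable_EFinP.
  under eq_integral do rewrite gee0_abs ?lee_fin//.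
  by rewrite -ge0_fin_numE// integral_ge0// => x _; rewrite lee_fin.
exists (fun N => \int[mu]_x pN N x - \int[mu]_x q x); split.
- move=> i j ij; rewrite lerB//; apply: le_Rintegral => // x _.
  by rewrite /pN le_min !ge_min lexx/= ler_nat ij orbT.
- move=> N; rewrite -RintegralB//.
  have lti : mu.-integrable setT (EFin \o log_truncation N).
    exact: (bounded_integrable mu (measurable_log_truncation N)
      (log_truncation_le N)).
  pose l x := ln (Num.max (Num.min (k x) (expR N%:R)) (expR (- N%:R))).
  have -> : \int[mu]_x log_truncation N x = \int[mu]_x l x.
    rewrite /Rintegral; congr fine; apply: ae_eq_integral => //.
    + exact/measurable_EFinP/measurable_log_truncation.
    + apply/measurable_EFinP; apply: measurableT_comp => //.
      apply: measurable_maxr => //; apply: measurable_minr => //.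
      exact: (ed_measurable_pos hk).
    + by move: (ed_ae hk); apply: filterS => x hkx _; rewrite /log_truncation
      /l hkx.
  (* The floor e^-N only raises [l]. If k <= e^N, the left side is at most p - q = ln k; otherwise
     it is at most the cap N. *)
  have lN x : pN N x - q x <= l x.
    have : ln (Num.min (k x) (expR N%:R)) <= l x.
      by rewrite ler_ln ?posrE ?lt_max ?lt_min ?k0 ?expR_gt0 ?le_max ?lexx.
    apply: le_trans; case: (leP (k x) (expR N%:R)) => kN.
      by rewrite -pBq lerB// ge_min lexx.
    rewrite expRK lerBlDr (le_trans (_ : _ <= N%:R))// ?lerDl//.
    by rewrite ge_min lexx orbT.
  apply: le_Rintegral => //.
  + rewrite (_ : EFin \o _ = (EFin \o pN N) \- (EFin \o q))%E//.
    exact: integrableB.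
  + apply: (@bounded_integrable _ _ _ mu N%:R) => [|x].
      apply: measurableT_comp => //.
      apply: measurable_maxr => //; apply: measurable_minr => //.
      exact: (ed_measurable_pos hk).
    exact: ln_clamp_le.
- have cp : (\int[mu]_x (pN N x)%:E)%E @[N --> \oo] --> (\int[mu]_x (p x)%:E)%E.
    rewrite (_ : (\int[mu]_x (p x)%:E)%E =
        (\int[mu]_x limn (fun N => (pN N x)%:E))%E).
      apply: (@cvg_monotone_convergence _ T R mu setT measurableT (fun N x =>
        (pN N x)%:E)).
      - by move=> N; exact/measurable_EFinP.
      - by move=> N x _; rewrite lee_fin.
      - move=> x _ i j ij; rewrite lee_fin /pN le_min !ge_min lexx/= ler_nat ij.
        by rewrite orbT.
    apply: eq_integral => x _; apply/esym/cvg_lim => //; apply: cvg_near_cst.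
    have [N0 _ HN0] := nbhs_infty_ger (p x).
    by exists N0 => // N /HN0 pxN; rewrite /pN min_l.
  rewrite KLE (_ : (fun N => _) = (fun N => \int[mu]_x (pN N x)%:E - \int[mu]_x
    (q x)%:E)%E).
    apply: cvgeB => //; last exact: cvg_cst.
    by apply: fin_num_adde_defl; rewrite fin_numN.
  apply/funext => N; rewrite EFinB /Rintegral !fineK//.
  by have := integrable_fin_num measurableT (pNi N).
Qed.

End relative_entropy.

(** * Marginals and the contraction of entropy *)

Section marginals.
Context {R : realType} {M : nat} (d : 'I_M -> nat).
Local Notation n := (\sum_m d m)%N.
Local Notation b := (@tagnat.sig1 M d).
Implicit Types (P mu pi : probability 'rV[R]_n R).

Lemma drop_block_mix_block (m : 'I_M) (t : R) (x y : 'rV[R]_n) :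
  drop_block m (mix_block b t m x y) = drop_block m x.
Proof.
apply/rowP => i; rewrite !mxE tagnat.Rank1K.
by rewrite eq_sym (negbTE (neq_lift _ _)).
Qed.

Lemma Rintegral_marginal_drop (m : 'I_M) P (D : R)
    (f : 'rV[R]_(\sum_(j < M.-1) d (lift m j)) -> R) : measurable_fun setT f ->
  (forall x, `|f x| <= D) ->
  \int[marginal_drop m P]_y f y = \int[P]_x f (drop_block m x).
Proof.
move=> mf fD; rewrite /Rintegral; congr fine.
rewrite (integral_distribution (f := EFin \o f))//; first
  exact/measurable_EFinP.
apply: (@bounded_integrable _ _ _ P D) => //.
by apply: (measurableT_comp mf); exact: measurable_drop_block.
Qed.

Lemma marginal_drop_dominates (m : 'I_M) mu pi : mu `<< pi ->
  marginal_drop m mu `<< marginal_drop m pi.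
Proof.
move=> /null_content_dominatesP mupi; apply/null_content_dominatesP => A mA A0.
apply: mupi => //; rewrite -[X in measurable X]setTI.
exact: measurable_drop_block.
Qed.

End marginals.

Section entropy_contraction.
Context {R : realType} {M : nat} (d : 'I_M -> nat).
Local Notation n := (\sum_m d m)%N.
Variables (U0 : 'rV[R]_n -> R) (Um : forall m, 'rV[R]_(d m) -> R).
Variables (L : 'I_M -> R) (lambda : R) (pi mu : probability 'rV[R]_n R).
Hypothesis M_gt0 : (0 < M)%N.
Hypothesis L_gt0 : forall m, 0 < L m.
Hypothesis assumption : blockwise_convex_smooth U0 Um L lambda.
Hypothesis pi_density :
  has_lebesgue_density pi (fun x => expR (- potential U0 Um x)).

Lemma KL_dominates dd (T : measurableType dd) (P Q : probability T R) :
  (KL P Q < +oo)%E -> P `<< Q.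
Proof. by rewrite /KL; case: pselect. Qed.

Lemma KL_ge0 dd (T : measurableType dd) (P Q : probability T R) :
  (0 <= KL P Q)%E.
Proof.
have [/KL_dominates PQ|] := ltP (KL P Q) +oo%E; last by apply: le_trans.
have [h [k hk]] := entropy_density_exists PQ.
have := donsker_varadhan hk (measurable_cst (0 : R)) (D := 0).
move=> /(_ (fun x => _))/=.
rewrite Rintegral_probability_cst.
under eq_Rintegral do rewrite expR0.
by rewrite Rintegral_probability_cst ln1 adde0; apply => x; rewrite normr0.
Qed.

(** The test functions are the truncated log-densities of the marginals, pulled back by
    [drop_block]. Donsker-Varadhan for their sum divided by M - t, multiplied by M - t, produces the
    log-integral that Brascamp-Lieb bounds; each resulting ln of the integral of exp(g_m) is close
    to 0. *)
Lemma sum_KL_marginal_le (t : R) : 0 < t -> t < 1 -> t <= lambda ->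
  (KL mu pi < +oo)%E ->
  (forall m, KL (marginal_drop m mu) (marginal_drop m pi) \is a fin_num) /\
  \sum_m fine (KL (marginal_drop m mu) (marginal_drop m pi)) <=
    (M%:R - t) * fine (KL mu pi).
Proof.
move=> t0 t1 tl KLoo; have mupi := KL_dominates KLoo.
have KLfin : KL mu pi \is a fin_num by rewrite ge0_fin_numE// KL_ge0.
have Mt : 0 < M%:R - t by rewrite subr_gt0 (lt_le_trans t1)// ler1n.
have [h0 [k0 hk0]] := entropy_density_exists mupi.
have /cid[h hP] : exists h : forall m, 'rV[R]_(\sum_(j < M.-1) d (lift m j)) ->
  R,
    forall m, exists k, entropy_density (marginal_drop m mu) (marginal_drop m
      pi) (h m) k.
  pose hh m := cid (entropy_density_exists (@marginal_drop_dominates _ _ _ m _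
    _ mupi)).
  by exists (fun m => sval (hh m)) => m; exact: (svalP (hh m)).
have /cid[a aP] : exists a : 'I_M -> nat -> R, forall m,
    [/\ {homo a m : i j / (i <= j)%N >-> i <= j},
      forall N, a m N <= \int[marginal_drop m mu]_x log_truncation (h m) N x &
      (a m N)%:E @[N --> \oo] --> KL (marginal_drop m mu) (marginal_drop m pi)].
  have aa m : exists a : nat -> R, [/\ {homo a : i j / (i <= j)%N >-> i <= j},
      forall N, a N <= \int[marginal_drop m mu]_x log_truncation (h m) N x &
      (a N)%:E @[N --> \oo] --> KL (marginal_drop m mu) (marginal_drop m pi)].
    by have [k hk] := hP m; exact: log_truncation_approx hk.
  by exists (fun m => sval (cid (aa m))) => m; exact: (svalP (cid (aa m))).
pose g N m x := log_truncation (h m) N (drop_block m x).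
have mlt N m : measurable_fun setT (log_truncation (h m) N).
  by have [k hk] := hP m; exact: measurable_log_truncation hk N.
have ltN N m x : `|log_truncation (h m) N x| <= N%:R by exact: ln_clamp_le.
have mg N m : measurable_fun setT (g N m).
  by apply: (measurableT_comp (mlt N m)); exact: measurable_drop_block.
have gN N m x : `|g N m x| <= N%:R by exact: ltN.
(* Each block costs ln(1 + e^-N) <= e^-N <= 1 / (N + 1), the last step because e^N >= 1 + N. *)
have sum_a N : \sum_m a m N <= (M%:R - t) * fine (KL mu pi) + M%:R * harmonic N.
  pose s x := (\sum_m g N m x) / (M%:R - t).
  have ms : measurable_fun setT s.
    by apply: measurable_funM => //; exact: measurable_sum.
  pose C := M%:R * N%:R / (M%:R - t) : R.
  have sC x : `|s x| <= C.
    rewrite /s /C normrM [`|_^-1|]gtr0_norm ?invr_gt0// ler_pM2r ?invr_gt0//.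
    apply: (le_trans (ler_norm_sum _ _ _)).
    by rewrite -[M in M%:R * _]card_ord mulr_natl -sumr_const; apply: ler_sum.
  have DV := donsker_varadhan hk0 ms sC.
  rewrite -(fineK KLfin) -EFinD lee_fin in DV.
  have BL := gibbs_brascamp_lieb L_gt0 assumption pi_density M_gt0 t0 t1 tl
    (mg N) (gN N) (fun m x y => congr1 _ (drop_block_mix_block m t x y)).
  have Is : (M%:R - t) * \int[mu]_x s x = \sum_m \int[mu]_x g N m x.
    have gi m : mu.-integrable setT (EFin \o g N m).
      exact: (bounded_integrable mu (mg N m) (gN N m)).
    have sgi : mu.-integrable setT (EFin \o (fun x => \sum_m g N m x)).
      rewrite (_ : EFin \o _ = fun x => (\sum_m (EFin \o g N m) x)%E).
        exact: integrable_sum.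
      by apply/funext => x /=; rewrite sumEFin.
    rewrite /s RintegralZr// mulrCA divff ?gt_eqF// mulr1.
    apply: EFin_inj; rewrite -sumEFin [in LHS]/Rintegral fineK; last first.
      exact: (integrable_fin_num measurableT sgi).
    under eq_integral do rewrite -sumEFin.
    rewrite integral_sum//; apply: eq_bigr => m _.
    by rewrite /Rintegral fineK//; exact: (integrable_fin_num measurableT (gi
      m)).
  have lnb m : ln (\int[pi]_x expR (g N m x)) <= harmonic N.
    have [k hk] := hP m.
    have := log_truncation_expR hk N.
    rewrite (@Rintegral_marginal_drop _ _ _ m pi (expR N%:R)); last 2 first.
    - by apply: measurableT_comp.
    - move=> x; rewrite ger0_norm ?expR_ge0// ler_expR.
      exact: (le_trans (ler_norm _) (ltN _ _ _)).
    move=> Ile; have I0 := bounded_expR_integral_gt0 pi (mg N m) (gN N m).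
    apply: (@le_trans _ _ (expR (- N%:R))).
      apply: (@le_trans _ _ (ln (1 + expR (- N%:R)))).
        by rewrite ler_ln ?posrE// ltr_wpDr ?expR_ge0.
      by apply: le_ln1Dx; rewrite (lt_le_trans _ (expR_ge0 _))// ltrN10.
    rewrite expRN /harmonic lef_pV2 ?posrE ?expR_gt0// -natr1 addrC.
    exact: expR_ge1Dx.
  have sumg : \sum_m a m N <= \sum_m \int[mu]_x g N m x.
    apply: ler_sum => m _; have [_ /(_ N) aN _] := aP m.
    apply: (le_trans aN).
    rewrite (@Rintegral_marginal_drop _ _ _ m mu N%:R _ (mlt N m) (ltN N m)).
    exact: lexx.
  rewrite (le_trans sumg)// -Is.
  have sumln : \sum_m ln (\int[pi]_x expR (g N m x)) <= M%:R * harmonic N.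
    by rewrite -[M in M%:R * _]card_ord mulr_natl -sumr_const; apply: ler_sum.
  have := ler_wpM2l (ltW Mt) DV; rewrite mulrDr; lra.
have harm1 N : harmonic N <= 1 :> R.
  by rewrite /harmonic invf_le1 ?ler1n.
(* Finiteness comes before passing to the limit in the reals: in the bound on the sum, the other
   blocks are at least a j 0, so a m N is bounded uniformly in N. *)
have KLm m : KL (marginal_drop m mu) (marginal_drop m pi) \is a fin_num.
  have [_ _ acvg] := aP m; rewrite ge0_fin_numE ?KL_ge0//.
  pose C := (M%:R - t) * fine (KL mu pi) + M%:R - \sum_(j | j != m) a j 0%N.
  apply: (@le_lt_trans _ _ C%:E); last exact: ltry.
  rewrite -(cvg_lim _ acvg)//; apply: lime_le.
    by apply/cvg_ex; eexists; exact: acvg.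
  apply: nearW => N; rewrite lee_fin /C lerBrDr.
  apply: (@le_trans _ _ (\sum_m a m N)).
    rewrite [leRHS](bigD1 m)//= lerD2l; apply: ler_sum => j _.
    by have [homo_a _ _] := aP j; exact: homo_a.
  rewrite (le_trans (sum_a N))// lerD2l -[leRHS]mulr1.
  by rewrite ler_wpM2l.
split => //.
have ca m : a m N @[N --> \oo] --> fine (KL (marginal_drop m mu) (marginal_drop
  m pi)).
  have [_ _ acvg] := aP m; apply: (@fine_cvg _ _ _ _ (fun N => (a m N)%:E)).
  by rewrite fineK.
have cs : \sum_m a m N - M%:R * harmonic N @[N --> \oo] -->
    \sum_m fine (KL (marginal_drop m mu) (marginal_drop m pi)) - M%:R * 0.
  apply: cvgB; last by apply: cvgMl_tmp; exact: cvg_harmonic.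
  apply: (@cvg_big R 'I_M +%R 0 xpredT _ nat _ (index_enum 'I_M) a) => //.
  exact: add_continuous.
rewrite mulr0 subr0 in cs.
rewrite -(cvg_lim _ cs)//; apply: limr_le.
  by apply/cvg_ex; eexists; exact: cs.
by apply: nearW => N; rewrite lerBlDr.
Qed.

(** Any t below lambda is below 1, so the previous bound applies, and t is pushed up to lambda. *)
Lemma sum_KL_marginal_le_lambda : lambda <= 1 -> 0 < lambda ->
  (KL mu pi < +oo)%E ->
  (forall m, KL (marginal_drop m mu) (marginal_drop m pi) \is a fin_num) /\
  \sum_m fine (KL (marginal_drop m mu) (marginal_drop m pi)) <=
    (M%:R - lambda) * fine (KL mu pi).
Proof.
move=> l1 l0 KLoo; set S := \sum_m _; set K := fine _.
have K0 : 0 <= K by apply: fine_ge0; exact: KL_ge0.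
have H t : 0 < t -> t < lambda -> S <= (M%:R - t) * K.
  move=> t0 tl.
  by have [_] := sum_KL_marginal_le t0 (lt_le_trans tl l1) (ltW tl) KLoo.
split.
  have h0 : 0 < lambda / 2 by lra.
  have h1 : lambda / 2 < 1 by lra.
  have h2 : lambda / 2 <= lambda by lra.
  by have [] := sum_KL_marginal_le h0 h1 h2 KLoo.
apply/ler_addgt0Pr => e e0.
(* This makes (lambda - t) K at most e; lambda / 2 keeps t positive, and K + 1 allows for K = 0. *)
pose t := Num.max (lambda / 2) (lambda - e / (K + 1)).
have K1 : 0 < K + 1 by rewrite ltr_wpDl.
have eK : 0 < e / (K + 1) by rewrite divr_gt0.
have t0 : 0 < t by rewrite lt_max divr_gt0.
have tl : t < lambda by rewrite gt_max; apply/andP; split; lra.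
have : lambda - t <= e / (K + 1) by rewrite lerBlDr -lerBlDl le_max lexx orbT.
rewrite ler_pdivlMr// => te.
by rewrite (le_trans (H t t0 tl))//; nra.
Qed.

End entropy_contraction.

(** Covers the zero-dimensional cases: total dimension 0, and the marginals when M = 1. *)
Lemma KL_subsingleton {R : realType} dd (T : measurableType dd)
    (P Q : probability T R) : (forall x y : T, x = y) -> KL P Q = 0%E.
Proof.
move=> T1.
have [x0 _] : exists x : T, True.
  apply: contrapT => nT; have := probability_setT P.
  rewrite (_ : setT = set0) ?measure0.
    by case=> /eqP; rewrite eq_sym oner_eq0.
  by apply/seteqP; split => // x _; apply: nT; exists x.
have AT (A : set T) : A = set0 \/ A = setT.
  have [[x Ax]|nA] := pselect (exists x, A x).
    by right; apply/seteqP; split => // y _; rewrite (T1 y x).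
  by left; apply/seteqP; split => // x Ax; apply: nA; exists x.
have PQ : P `<< Q.
  apply/null_content_dominatesP => A mA; have [->|->] := AT A; first by rewrite
    !measure0.
  rewrite [X in X = _ -> _]probability_setT => -[] /eqP.
  by rewrite oner_eq0.
have [h [k hk]] := entropy_density_exists PQ.
have h1 : h x0 = 1.
  apply: EFin_inj; rewrite -(ed_integral hk).
  rewrite (eq_integral (cst (h x0)%:E)); last by move=> x _; rewrite (T1 x x0).
  by rewrite integral_cst// [X in (_ * X)%E]probability_setT mule1.
have k1 : k x0 = 1.
  rewrite -h1; have [//|hkx0] := eqVneq (k x0) (h x0).
  have [N [mN N0 subN]] := ed_ae hk.
  have NT : N = setT.
    apply/seteqP; split => // x _; apply: subN => /= hkx.
    by move/eqP: hkx0; apply; rewrite (T1 x0 x).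
  by move: N0; rewrite NT probability_setT => -[] /eqP; rewrite oner_eq0.
rewrite (ed_KL hk); apply: integral0_eq => x _.
by rewrite (T1 x x0) k1 ln1.
Qed.

Theorem theorem3p1 (R : realType) (M : nat) (d : 'I_M -> nat)
    (U0 : 'rV[R]_(\sum_m d m) -> R) (Um : forall m, 'rV[R]_(d m) -> R)
    (L : 'I_M -> R) (lambda kappa : R)
    (pi : probability 'rV[R]_(\sum_m d m) R)
    (M_gt0 : (0 < M)%N)
    (L_gt0 : forall m, 0 < L m)
    (lambda_gt0 : 0 < lambda)
    (kappaE : kappa = 1 / lambda)
    (assumption : blockwise_convex_smooth U0 Um L lambda)
    (pi_density : has_lebesgue_density pi (fun x => expR (- potential U0 Um x)))
    (mu : probability 'rV[R]_(\sum_m d m) R) :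
  ((1 / M%:R)%:E * \sum_(m < M) KL (marginal_drop m mu) (marginal_drop m pi)
    <= (1 - 1 / (kappa * M%:R))%:E * KL mu pi)%E.
Proof.
have M0 : 0 < M%:R :> R by rewrite ltr0n.
have -> : 1 / (kappa * M%:R) = lambda / M%:R.
  by rewrite kappaE; field; rewrite !gt_eqF.
have rV0 k (kz : k = 0%N) (x y : 'rV[R]_k) : x = y.
  by move: x y; rewrite kz => x y; apply/rowP => -[].
(* Without coordinates lambda <= 1 may fail and the factor on the right may be negative, but every
   entropy is 0. *)
have [n0|] := posnP (\sum_m d m)%N.
  rewrite (KL_subsingleton mu pi (rV0 _ n0)) mule0 big1 ?mule0// => m _.
  apply: KL_subsingleton; apply: rV0.
  apply/eqP; rewrite sum_nat_eq0; apply/forallP => j /=.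
  by move/eqP : n0; rewrite sum_nat_eq0 => /forallP/(_ (lift m j)).
move=> n_gt0.
have l1 := blockwise_lambda_le1 L_gt0 assumption (Ordinal n_gt0).
have M1 : 1 <= M%:R :> R by rewrite ler1n.
have [KLoo|] := ltP (KL mu pi) +oo%E; last first.
  rewrite leye_eq => /eqP ->.
  (* If lambda < M the right side is +oo. Otherwise lambda <= 1 forces M = lambda = 1, and the right
     side is 0 * +oo = 0; the left side is 0 too, since the only marginal lives on a one-point
     space. *)
  have [lM|Ml] := ltP lambda M%:R.
    by rewrite gt0_muley ?leey// lte_fin subr_gt0 ltr_pdivrMr// mul1r.
  have M_1 : M = 1%N.
    by apply/eqP; rewrite eqn_leq M_gt0 andbT -(ler_nat R) (le_trans Ml).
  rewrite big1 ?mule0; last first.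
    move=> m _; apply: KL_subsingleton; apply: rV0.
    by apply: big1 => -[j jM]; exfalso; move: jM; rewrite M_1.
  rewrite mule_ge0 ?leey// lee_fin subr_ge0 ler_pdivrMr// mul1r.
  exact: le_trans l1 M1.
have [fin le] := sum_KL_marginal_le_lambda M_gt0 L_gt0 assumption pi_density
  l1 lambda_gt0 KLoo.
have KLfin : KL mu pi \is a fin_num by rewrite ge0_fin_numE// KL_ge0.
rewrite (eq_bigr (fun m => (fine (KL (marginal_drop m mu) (marginal_drop m pi)))%:E)).
  rewrite sumEFin -(fineK KLfin) -!EFinM lee_fin mul1r ler_pdivrMl//.
  by rewrite mulrA mulrBr mulr1 mulrCA divff ?gt_eqF// mulr1.
by move=> m _; rewrite fineK.
Qed.
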